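(* Let $(A,\mathfrak m)$ be a Cohen-Macaulay (Noetherian) local ring of dimension at most $1$ with infinite residue field, and let $I$ be an integrally closed $\mathfrak m$-primary ideal of $A$. If $e_2(I)=e_1(I)-e_0(I)+\lambda(A/I)$, then (i) $\deg h_I(t)\le 2$; (ii) $G(I)$ is Cohen-Macaulay.
   Context: $\lambda(-)$ denotes length. For an $\mathfrak m$-primary ideal $I$ of a $d$-dimensional Noetherian local ring $(A,\mathfrak m)$, the Hilbert series is $\sum_{n\ge 0}\lambda(I^n/I^{n+1})t^n=\dfrac{h_I(t)}{(1-t)^d}$ with $h_I(t)\in\mathbb Z[t]$, $h_I(1)\ne 0$; $h_I(t)$ is the $h$-polynomial of $I$. The Hilbert coefficients are defined for all $i\ge 0$ (including $i>d$) by $e_i(I)=h_I^{(i)}(1)/i!$, where $h_I^{(i)}$ is the $i$-th formal derivative. $G(I)=\bigoplus_{n\ge 0}I^n/I^{n+1}$ is the associated graded ring of $I$. *)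

(* Defs.v *)
From HB Require Import structures.
From mathcomp Require Import all_boot all_order all_algebra.
From mathcomp Require Import mathcomp_extra boolp classical_sets cardinality.

Set Implicit Arguments.
Unset Strict Implicit.
Unset Printing Implicit Defensive.
Import GRing.Theory.
Local Open Scope classical_set_scope.
Local Open Scope ring_scope.
Local Open Scope quotient_scope.

Definition strict_chain (T : Type) (F : set (set T)) (k : nat)
    (c : nat -> set T) : Prop :=
  (forall i, (i <= k)%N -> F (c i)) /\
  (forall i, (i < k)%N -> c i `<` c i.+1).

(* [n] is the largest length [k] of a strict chain [c 0 < c 1 < ... < c k] of
   members of [F]. *)
Definition chain_height (T : Type) (F : set (set T)) (n : nat) : Prop :=
  (exists c, strict_chain F n c) /\
  (forall k c, strict_chain F k c -> (k <= n)%N).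

Section CommutativeAlgebra.
Variable R : comPzRingType.
Implicit Types (I J K M P m : set R).

Definition ideal I : Prop :=
  [/\ I 0, (forall a b, I a -> I b -> I (a + b))
    & (forall r a, I a -> I (r * a))].

Definition ideal_gen (X : set R) : set R := smallest ideal X.

Definition ideal_mul I J : set R := ideal_gen [set a * b | a in I & b in J].

Fixpoint ideal_exp I (n : nat) : set R :=
  if n is n'.+1 then ideal_mul I (ideal_exp I n') else setT.

Definition prime_ideal P : Prop :=
  [/\ ideal P, ~ P 1 & forall a b, P (a * b) -> P a \/ P b].

Definition maximal_ideal M : Prop :=
  [/\ ideal M, M <> setT
    & forall J, ideal J -> M `<=` J -> J = M \/ J = setT].

Definition radical I : set R := [set x | exists n : nat, I (x ^+ n)].

Definition primary_ideal I : Prop :=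
  [/\ ideal I, I <> setT
    & forall a b, I (a * b) -> I a \/ radical I b].

Definition is_primary_to m I : Prop := primary_ideal I /\ radical I = m.

Definition noetherian : Prop :=
  forall I, ideal I -> exists s : seq R, I = ideal_gen [set` s].

Definition local_ring m : Prop :=
  maximal_ideal m /\ (forall M, maximal_ideal M -> M = m).

Definition krull_dim (d : nat) : Prop := chain_height prime_ideal d.

(* The length of the [R]-module [J / K], for ideals [K] included in [J]: its
   submodules are the [L / K] for [L] an ideal between [K] and [J]. *)
Definition has_length J K (n : nat) : Prop :=
  chain_height [set L | [/\ ideal L, K `<=` L & L `<=` J]] n.

Definition regular_sequence (s : seq R) : Prop :=
  ~ ideal_gen [set` s] 1 /\
  (forall i a, (i < size s)%N ->
     ideal_gen [set` take i s] (s`_i * a) -> ideal_gen [set` take i s] a).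

Definition has_depth m (n : nat) : Prop :=
  (exists s, [/\ regular_sequence s, [set` s] `<=` m & size s = n]) /\
  (forall s, regular_sequence s -> [set` s] `<=` m -> (size s <= n)%N).

Definition cm_local m : Prop :=
  [/\ noetherian, local_ring m & exists d, krull_dim d /\ has_depth m d].

(* The elements of [R / m] are represented by the cosets [a + m]. *)
Definition infinite_residue_field m : Prop :=
  infinite_set (range (fun a : R => [set b : R | m (b - a)])).

Definition integral_closure I : set R :=
  [set x | exists (n : nat) (a : nat -> R),
     [/\ (0 < n)%N, (forall i, (0 < i <= n)%N -> ideal_exp I i (a i))
       & x ^+ n + \sum_(1 <= i < n.+1) a i * x ^+ (n - i) = 0]].

Definition integrally_closed I : Prop := integral_closure I = I.

End CommutativeAlgebra.

Arguments noetherian R : clear implicits.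
Arguments krull_dim R d : clear implicits.

(* [f] exhibits [S] as the localization of [R] at the prime ideal [P]; this
   determines [S] up to a unique isomorphism. *)
Definition is_localization_at (R S : comPzRingType) (P : set R)
    (f : {rmorphism R -> S}) : Prop :=
  [/\ (forall s, ~ P s -> exists t, f s * t = 1),
      (forall y, exists a s, ~ P s /\ y * f s = f a)
    & (forall a b, f a = f b -> exists s, ~ P s /\ s * a = s * b)].

Definition cohen_macaulay (R : comPzRingType) : Prop :=
  noetherian R /\
  (forall M : set R, maximal_ideal M ->
   forall (S : comPzRingType) (f : {rmorphism R -> S}),
     is_localization_at M f -> exists n : set S, cm_local n).

Section HilbertSeries.
Variables (A : comNzRingType) (I : set A).

(* [h(t) = (1 - t)^d * \sum_n lambda(I^n / I^(n+1)) t^n] as formal power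
   series over the integers, where [1 - t] is invertible. *)
Definition is_h_polynomial (d : nat) (h : {poly int}) : Prop :=
  h.[1] != 0 /\
  exists2 H : nat -> nat,
    (forall n, has_length (ideal_exp I n) (ideal_exp I n.+1) (H n))
  & (forall n, h`_n = \sum_(i < n.+1) ((1 - 'X) ^+ d)`_i * (H (n - i)%N)%:Z).

End HilbertSeries.

(* [h^`N(i)] is the [i]-th formal derivative of [h] divided by [i!]. *)
Definition hilbert_coef (h : {poly int}) (i : nat) : int := (h^`N(i)).[1].

Section IdealPowers.
Variable R : comPzRingType.
Implicit Types I J : set R.

Lemma ideal_genP (X : set R) : ideal (ideal_gen X).
Proof.
split=> [J [[J0 _ _] _] //|a b Ia Ib J JX|r a Ia J JX].
  by case: (JX) => -[_ JD _] _; apply: JD; [apply: Ia|apply: Ib].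
by case: (JX) => -[_ _ JM] _; apply: JM; apply: Ia.
Qed.

Lemma ideal_expP I n : ideal (ideal_exp I n).
Proof. by case: n => [|n] //=; apply: ideal_genP. Qed.

Lemma idealN J a : ideal J -> J a -> J (- a).
Proof. by move=> [_ _ JM] Ja; rewrite -mulN1r; apply: JM. Qed.

Lemma ideal_sum J (n : nat) (F : 'I_n -> R) :
  ideal J -> (forall i, J (F i)) -> J (\sum_(i < n) F i).
Proof. by move=> [J0 JD _] JF; apply: big_ind. Qed.

Lemma ideal_expS I n : ideal_exp I n.+1 `<=` ideal_exp I n.
Proof.
apply: smallest_sub; first exact: ideal_expP.
move=> _ [a Ia [b Ib <-]]; case: (ideal_expP I n) => _ _; exact.
Qed.

Lemma ideal_expM I i j a b :
  ideal_exp I i a -> ideal_exp I j b -> ideal_exp I (i + j) (a * b).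
Proof.
elim: i a => [|i IHi] a /=.
  by move=> _ Ib; case: (ideal_expP I j) => _ _; apply.
move=> Ia Ib.
have [E0 ED EM] := ideal_expP I (i + j).+1.
pose X : set R := [set c | ideal_exp I (i + j).+1 (c * b)].
have XI : ideal X.
  split=> [|c d|r c]; rewrite /X /= ?mul0r ?mulrDl -?mulrA //.
    exact: ED.
  exact: EM.
apply: (smallest_sub XI _ Ia) => _ [x Ix [y Iy <-]]; rewrite /X /= -mulrA.
by apply: sub_gen_smallest; exists x => //; exists (y * b) => //; apply: IHi.
Qed.

End IdealPowers.

(* [G(I)] is the quotient of the Rees ring [\bigoplus_n I^n t^n], a subring of
   [A[t]], by its ideal [\bigoplus_n I^(n+1) t^n]. *)
Section AssociatedGradedRing.
Variables (A : comNzRingType) (I : set A).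

Definition rees_pred : {pred {poly A}} :=
  fun p => `[< forall n, ideal_exp I n p`_n >].

Lemma rees_subring_closed : subring_closed rees_pred.
Proof.
split=> [|p q /asboolP Ip /asboolP Iq|p q /asboolP Ip /asboolP Iq];
  apply/asboolP => n.
- rewrite coef1; case: n => [//|n] /=; have [] := ideal_expP I n.+1; by [].
- rewrite coefB; have E := ideal_expP I n; case: (E) => _ ED _.
  by apply: ED => //; apply: idealN.
- rewrite coefM; apply: ideal_sum => [|i]; first exact: ideal_expP.
  by rewrite -[n in ideal_exp I n](subnKC (leq_ord i)); apply: ideal_expM.
Qed.

HB.instance Definition _ :=
  GRing.isSubringClosed.Build {poly A} rees_pred rees_subring_closed.

Record rees := Rees { rees_poly :> {poly A}; _ : rees_poly \in rees_pred }.

HB.instance Definition _ := [isSub for rees_poly].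
HB.instance Definition _ := [Choice of rees by <:].
HB.instance Definition _ := [SubChoice_isSubComNzRing of rees by <:].

Definition rees_shift : {pred rees} :=
  fun p => `[< forall n, ideal_exp I n.+1 (rees_poly p)`_n >].

Lemma rees_shift_zmod_closed : zmod_closed rees_shift.
Proof.
split=> [|p q /asboolP Ip /asboolP Iq]; apply/asboolP => n.
  by rewrite /= coef0; have [] := ideal_expP I n.+1.
rewrite -[rees_poly _]/(val (p - q)) rmorphB coefB.
have E := ideal_expP I n.+1; case: (E) => _ ED _.
by apply: ED; [exact: Ip|apply: (idealN E); exact: Iq].
Qed.

HB.instance Definition _ :=
  GRing.isZmodClosed.Build rees rees_shift rees_shift_zmod_closed.

Lemma rees_shiftM (p q : rees) : q \in rees_shift -> p * q \in rees_shift.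
Proof.
move=> /asboolP Iq; apply/asboolP => n; case: p => p /asboolP Ip /=.
rewrite coefM; apply: (ideal_sum (ideal_expP I n.+1)) => i.
rewrite -[n in ideal_exp I n.+1](subnKC (leq_ord i)) -addnS.
exact: ideal_expM.
Qed.

Definition assoc_graded := {ideal_quot rees_shift}.
HB.instance Definition _ := GRing.Zmodule.on assoc_graded.

Definition gr_one : assoc_graded := \pi_assoc_graded 1.
Definition gr_mul (x y : assoc_graded) : assoc_graded :=
  \pi_assoc_graded (repr x * repr y).

Lemma pi_gr_mul (p q : rees) :
  gr_mul (\pi_assoc_graded p) (\pi_assoc_graded q) = \pi_assoc_graded (p * q).
Proof.
have eqG (a b : rees) : a - b \in rees_shift ->
    \pi_assoc_graded a = \pi_assoc_graded b.
  by move=> ab; apply/eqP; rewrite -Quotient.idealrBE.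
have reprG (a : rees) : repr (\pi_assoc_graded a) - a \in rees_shift.
  by rewrite Quotient.idealrBE; apply/eqP; rewrite reprK.
apply: eqG; set p' := repr _; set q' := repr _.
have -> : p' * q' - p * q = p' * (q' - q) + q * (p' - p).
  by rewrite !mulrBr addrA [q * p']mulrC subrK [q * p]mulrC.
by rewrite rpredD // rees_shiftM // reprG.
Qed.

Lemma gr_mulA : associative gr_mul.
Proof.
elim/quotW=> p; elim/quotW=> q; elim/quotW=> r.
rewrite (pi_gr_mul q r) (pi_gr_mul p q).
by rewrite (pi_gr_mul p (q * r)) (pi_gr_mul (p * q) r) mulrA.
Qed.

Lemma gr_mulC : commutative gr_mul.
Proof.
elim/quotW=> p; elim/quotW=> q.
by rewrite (pi_gr_mul p q) (pi_gr_mul q p) mulrC.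
Qed.

Lemma gr_mul1 : left_id gr_one gr_mul.
Proof. by elim/quotW=> p; rewrite (pi_gr_mul 1 p) mul1r. Qed.

Lemma gr_mulD : left_distributive gr_mul +%R.
Proof.
elim/quotW=> p; elim/quotW=> q; elim/quotW=> r.
rewrite (pi_gr_mul p r) (pi_gr_mul q r).
have piD (a b : rees) : \pi_assoc_graded a + \pi_assoc_graded b =
    \pi_assoc_graded (a + b).
  exact: esym (raddfD (\pi_{ideal_quot rees_shift}) a b).
by rewrite !piD (pi_gr_mul (p + q) r) mulrDl.
Qed.

HB.instance Definition _ :=
  GRing.Zmodule_isComPzRing.Build assoc_graded gr_mulA gr_mulC
    gr_mul1 gr_mulD.

End AssociatedGradedRing.

(* Main.v *)
Require Import Defs.
From HB Require Import structures.
From mathcomp Require Import all_boot all_order all_algebra.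
From mathcomp Require Import mathcomp_extra boolp classical_sets cardinality.
From mathcomp Require Import ring zify.

(* In dimension one, let (x) be a principal reduction of I and let v_n be the
   length of I^(n+1) / x I^n. Since I^n / x I^n has the same length e for all n,
   the Hilbert function is H(n) = e - v_n, so h_0 = e - v_0 and
   h_(n+1) = v_n - v_(n+1), and summation by parts turns the hypothesis on e_2
   into \sum_(n >= 2) (n - 1) v_n = 0. Hence I^(n+1) = x I^n for n >= 2. With
   I^2 : x = I, which holds because I is integrally closed, this makes the
   initial form of x regular on G(I). In dimension zero the hypothesis reads
   \sum_(n >= 3) C(n - 1, 2) H(n) = 0, so G(I) has finite length.

   A reduction exists because the residue field is infinite, so that I is not a
   finite union of proper subideals: build the associated graded ring from
   finitely many graded cyclic modules, on each of which every y in I outside of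
   a proper subideal is surjective in large degrees.

   For the localizations of G(I) at arbitrary, possibly non-homogeneous, maximal
   ideals, the bounded Hilbert function shows that G(I)/P has finite length as
   soon as the prime P is not minimal. So if M is not minimal then it contains
   a polynomial in the initial form of x with leading coefficient one, which is
   regular. *)

Set Implicit Arguments.
Unset Strict Implicit.
Unset Printing Implicit Defensive.
Import GRing.Theory Num.Theory.
Local Open Scope classical_set_scope.
Local Open Scope ring_scope.

(** * Length *)

Section Chains.

Lemma strict_chain_map (T T' : Type) (F : set (set T)) (F' : set (set T'))
    (g : set T -> set T') k c :
  (forall L, F L -> F' (g L)) ->
  (forall L L', F L -> F L' -> L `<` L' -> g L `<` g L') ->
  strict_chain F k c -> strict_chain F' k (g \o c).
Proof.
move=> FF' gS [Fc Sc]; split=> i ik /=; first exact/FF'/Fc.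
by apply: gS; [apply: Fc; exact: ltnW|exact: Fc|exact: Sc].
Qed.

Lemma strict_chain_sub (T : Type) (F F' : set (set T)) k c :
  F `<=` F' -> strict_chain F k c -> strict_chain F' k c.
Proof. by move=> FF' [Fc Sc]; split=> // i ik; exact/FF'/Fc. Qed.

Lemma strict_chain_rcons (T : Type) (F : set (set T)) k c b :
  strict_chain F k c -> F b -> c k `<` b ->
  strict_chain F k.+1 (fun i => if (i <= k)%N then c i else b).
Proof.
move=> [Fc Sc] Fb cb; split=> i; first by case: (leqP i k) => // ik _; apply: Fc.
rewrite ltnS => ik; rewrite ik; case: (ltnP i k) => [/Sc//|ki].
by have -> : i = k by apply/eqP; rewrite eqn_leq ik ki.
Qed.

(** Cutting a strict chain with a fixed module, or adding the module to it, can produce repetitions.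
    This step drops them, and its last clause records when the length really grows. *)
Lemma strict_chain_extend (T : Type) (F : set (set T)) p c X Y :
  strict_chain F p c -> c p = X -> F Y -> X `<=` Y ->
  exists p' c', [/\ (p <= p')%N, strict_chain F p' c', c' p' = Y
                  & ~ (Y `<=` X) -> (p < p')%N].
Proof.
move=> Fc <- FY XY; have [YX|nYX] := pselect (Y `<=` c p).
  by exists p, c; split=> //; apply/seteqP.
exists p.+1; eexists; split; [exact: leqnSn|exact: (strict_chain_rcons Fc FY)| |by []].
by rewrite /= ltnn.
Qed.

Lemma chain_height_exists (T : Type) (F : set (set T)) n :
  F !=set0 -> (forall k c, strict_chain F k c -> (k <= n)%N) ->
  exists2 p, (p <= n)%N & chain_height F p.
Proof.
move=> [X FX] bF; pose Q k := `[< exists c, strict_chain F k c >].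
have Q0 : exists k, Q k.
  by exists 0; apply/asboolP; exists (fun=> X); split=> // i _.
have Qb k : Q k -> (k <= n)%N by move=> /asboolP[c /bF].
case: (ex_maxnP Q0 Qb) => p /asboolP[c Fc] pm; exists p; first exact: bF Fc.
by split=> [|k c' Fc']; [exists c|apply: pm; apply/asboolP; exists c'].
Qed.

Lemma chain_height_uniq (T : Type) (F : set (set T)) p q :
  chain_height F p -> chain_height F q -> p = q.
Proof.
move=> [[c Fc] pm] [[c' Fc'] qm]; apply/eqP.
by rewrite eqn_leq (pm _ _ Fc') (qm _ _ Fc).
Qed.

End Chains.

(** * Lengths of quotients of submodules *)

Section Submodules.
Variables (R : comPzRingType) (Phi : set R).
Implicit Types J K L N : set R.

(** [Phi] is an arbitrary set of scalars. With [setT] the submodules are the ideals; with the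
    scalars [F 1] of a filtration they include the pieces [F n], which need not be ideals. *)
Definition submod N : Prop :=
  [/\ N 0, (forall a b, N a -> N b -> N (a + b))
    & (forall r a, Phi r -> N a -> N (r * a))].

Definition msum J K : set R := [set z | exists2 a, J a & K (z - a)].

Definition mitv J K : set (set R) :=
  [set L | [/\ submod L, K `<=` L & L `<=` J]].

Definition len_le J K n : Prop :=
  forall k c, strict_chain (mitv J K) k c -> (k <= n)%N.

Definition len J K n : Prop := chain_height (mitv J K) n.

Lemma submod_cap J K : submod J -> submod K -> submod (J `&` K).
Proof.
move=> [J0 JD JM] [K0 KD KM]; split; first by [].
  by move=> a b [? ?] [? ?]; split; [apply: JD|apply: KD].
by move=> r a ? [? ?]; split; [apply: JM|apply: KM].
Qed.

Lemma submod_msum J K : submod J -> submod K -> submod (msum J K).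
Proof.
move=> [J0 JD JM] [K0 KD KM]; split; first by exists 0 => //; rewrite subr0.
  move=> a b [u Ju Ku] [v Jv Kv]; exists (u + v); first exact: JD.
  by rewrite opprD addrACA; apply: KD.
move=> r a Pr [u Ju Ku]; exists (r * u); first exact: JM.
by rewrite -mulrBr; apply: KM.
Qed.

Lemma msum_subl J K : K 0 -> J `<=` msum J K.
Proof. by move=> K0 a Ja; exists a => //; rewrite subrr. Qed.

Lemma msum_subr J K : J 0 -> K `<=` msum J K.
Proof. by move=> J0 a Ka; exists 0 => //; rewrite subr0. Qed.

Lemma msum_sub J K L : submod L -> J `<=` L -> K `<=` L -> msum J K `<=` L.
Proof.
move=> [_ LD _] JL KL z [a /JL La /KL Lb].
by rewrite -(subrK a z); apply: LD.
Qed.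

Lemma msumS J J' K K' : J `<=` J' -> K `<=` K' -> msum J K `<=` msum J' K'.
Proof. by move=> JJ KK z [a /JJ ? /KK ?]; exists a. Qed.

Lemma len_le0 J K : submod J -> submod K -> K `<=` J -> len_le J K 0 -> J `<=` K.
Proof.
move=> sJ sK KJ l0; apply: contrapT => nJK.
suff /l0 : strict_chain (mitv J K) 1 (fun i => if (i <= 0)%N then K else J) by [].
by apply: (@strict_chain_rcons _ _ 0 (fun=> K)); split=> // i _; split.
Qed.

Lemma len_leW J K n p : (n <= p)%N -> len_le J K n -> len_le J K p.
Proof. by move=> np l k c /l kn; apply: leq_trans np. Qed.

Lemma len_le_sub J K J' K' n :
  J' `<=` J -> K `<=` K' -> len_le J K n -> len_le J' K' n.
Proof.
move=> JJ KK l k c /(@strict_chain_sub _ _ (mitv J K)) h; apply/l/h.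
by move=> L [sL KL LJ]; split=> //; [apply: subset_trans KL|apply: subset_trans JJ].
Qed.

Lemma len_exists J K n : submod K -> K `<=` J -> len_le J K n ->
  exists2 p, (p <= n)%N & len J K p.
Proof. by move=> sK KJ bn; apply: chain_height_exists bn; exists K; split. Qed.

Lemma len_uniq J K p q : len J K p -> len J K q -> p = q.
Proof. exact: chain_height_uniq. Qed.

Lemma len_len_le J K n : len J K n -> len_le J K n.
Proof. by case. Qed.

Lemma len_ler J K n p : len J K n -> len_le J K p -> (n <= p)%N.
Proof. by move=> [[c hc] _] /(_ _ _ hc). Qed.

Lemma lenxx J : submod J -> len J J 0.
Proof.
move=> sJ; have b0 : len_le J J 0.
  move=> [//|k] c [Fc Sc]; have [_ J1 J1'] := Fc 1%N isT.
  have [_ J0 J0'] := Fc 0%N isT; have [_] := Sc 0%N isT; case.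
  exact: subset_trans J0.
by have [p] := len_exists sJ (@subset_refl _ J) b0; rewrite leqn0 => /eqP ->.
Qed.

Hypothesis PhiN : Phi (-1).

Lemma submodN N a : submod N -> N a -> N (- a).
Proof. by move=> [_ _ NM] Na; rewrite -mulN1r; apply: NM. Qed.

Lemma submodB N a b : submod N -> N a -> N b -> N (a - b).
Proof. by move=> sN Na Nb; case: (sN) => _ ND _; apply: ND => //; apply: submodN. Qed.

(** Intersections with [J] and sums with [J] both grow weakly along the chain. By the modular law at
    least one of them grows strictly at each step. *)
Lemma chain_split J K L k c : submod J -> submod L -> K `<=` J -> J `<=` L ->
  strict_chain (mitv L K) k c ->
  exists p q c1 c2, [/\ (k <= p + q)%N,
    strict_chain (mitv J K) p c1, c1 p = c k `&` J,
    strict_chain (mitv L J) q c2 & c2 q = msum (c k) J].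
Proof.
move=> sJ sL KJ JL; have [J0 _ _] := sJ.
have iK X : mitv L K X -> mitv J K (X `&` J).
  move=> [sX KX XL]; split; first exact: submod_cap.
    by move=> z Kz; split; [exact: KX|exact: KJ].
  by move=> z [].
have iJ X : mitv L K X -> mitv L J (msum X J).
  move=> [sX KX XL]; split; first exact: submod_msum.
    by apply: msum_subr; case: sX.
  exact: msum_sub.
elim: k => [|k IHk] [Fc Sc].
  exists 0, 0, (fun=> c 0 `&` J), (fun=> msum (c 0) J).
  by split=> //; split=> // i _; [apply: iK|apply: iJ]; exact: Fc.
have [|p [q [c1 [c2 [kpq h1 e1 h2 e2]]]]] := IHk.
  by split=> i ik; [exact/Fc/leqW|exact/Sc/leqW].
have Fk := Fc _ (leqnn k.+1); have [sX KX XL] := Fc _ (leqnSn k).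
have [cS ncS] := Sc _ (leqnn k.+1).
have [p' [c1' [pp' h1' e1' s1]]] := strict_chain_extend h1 e1 (iK _ Fk)
  (setSI (C := J) cS).
have [q' [c2' [qq' h2' e2' s2]]] := strict_chain_extend h2 e2 (iJ _ Fk)
  (msumS cS (@subset_refl _ J)).
exists p', q', c1', c2'; split=> //.
suff : (p < p')%N \/ (q < q')%N by lia.
have [E1|/s1] := pselect (c k.+1 `&` J `<=` c k `&` J); last by left.
have [E2|/s2] := pselect (msum (c k.+1) J `<=` msum (c k) J); last by right.
(* modular law: [c k] and [c k.+1] have the same intersection and sum with [J] *)
exfalso; apply: ncS => z cz; have [sX' _ _] := Fk.
have [a ca Jza] : msum (c k) J z by apply: E2; apply: msum_subl.
have [|cza _] := E1 (z - a); first by split=> //; apply: submodB => //; exact: cS.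
by case: sX => _ XD _; rewrite -(subrK a z); apply: XD.
Qed.

Lemma len_add J K L p q : submod J -> submod L -> K `<=` J -> J `<=` L ->
  len J K p -> len L J q -> len L K (p + q).
Proof.
move=> sJ sL KJ JL [[c hc] pm] [[e he] qm]; split; last first.
  move=> k b /(chain_split sJ sL KJ JL)[p' [q' [c1 [c2 [kpq /pm p'p _ /qm q'q _]]]]].
  exact: leq_trans kpq (leq_add p'p q'q).
exists (fun i => if (i <= p)%N then c i else e (i - p)%N); split=> i ik.
  case: (leqP i p) => ip.
    by have [? ? ?] := hc.1 _ ip; split=> //; apply: subset_trans JL.
  have [|? ? ?] := he.1 (i - p)%N; first by rewrite leq_subLR.
  by split=> //; apply: subset_trans KJ _.
case: (ltnP i p) => ip; first by rewrite (ltnW ip); exact: hc.2.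
have [pi|ei] : (p < i)%N \/ i = p by lia.
  by rewrite leqNgt pi /= subSn //; apply: he.2; lia.
subst i; rewrite leqnn subSn // subnn.
have q0 : (0 < q)%N by lia.
have [_ _ cJ] := hc.1 _ (leqnn p); have [_ Je _] := he.1 _ (leq0n q).
have [ee nee] := he.2 _ q0; split.
  exact: subset_trans cJ (subset_trans Je ee).
by move=> /subset_trans/(_ cJ)/subset_trans/(_ Je).
Qed.

Lemma len_split J K L n : submod J -> submod K -> submod L ->
  K `<=` J -> J `<=` L -> len L K n ->
  exists p q, [/\ len J K p, len L J q & n = (p + q)%N].
Proof.
move=> sJ sK sL KJ JL ln; have bn := len_len_le ln.
have [|p _ hp] := len_exists sK KJ (n := n); first exact: len_le_sub bn.
have [|q _ hq] := len_exists sJ JL (n := n); first exact: len_le_sub bn.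
exists p, q; split=> //; apply: len_uniq ln _; exact: len_add hp hq.
Qed.

Lemma len_le_add J K L p q : submod J -> submod L -> K `<=` J -> J `<=` L ->
  len_le J K p -> len_le L J q -> len_le L K (p + q).
Proof.
move=> sJ sL KJ JL pm qm k b.
move=> /(chain_split sJ sL KJ JL)[p' [q' [c1 [c2 [kpq /pm p'p _ /qm q'q _]]]]].
exact: leq_trans kpq (leq_add p'p q'q).
Qed.

Definition mspan (s : seq R) : set R := smallest submod [set` s].

Lemma mspanP s : submod (mspan s).
Proof.
split=> [N [[]]//|a b sa sb N|r a Pr sa N].
  by move=> NN; have [[_ ND _] _] := NN; apply: ND; [apply: sa|apply: sb].
by move=> NN; have [[_ _ NM] _] := NN; apply: NM => //; apply: sa.
Qed.

(** Among the chains ending in [msum (mspan s) K] with [s] taken from [L], a longest one must end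
    above [L], since a missing element could be appended to [s]. *)
Lemma len_le_fg J K L n : submod K -> len_le J K n -> mitv J K L ->
  exists2 s : seq R, [set` s] `<=` L & L `<=` msum (mspan s) K.
Proof.
move=> sK bn [sL KL LJ].
have FK s : [set` s] `<=` L -> mitv J K (msum (mspan s) K).
  move=> sL'; split; first exact: submod_msum (mspanP s) sK.
    by apply: msum_subr; case: (mspanP s).
  by apply: subset_trans LJ; apply: msum_sub => //; apply: smallest_sub.
pose Q k := `[< exists s c, [/\ [set` s] `<=` L, strict_chain (mitv J K) k c
  & c k = msum (mspan s) K] >].
have Q0 : exists k, Q k.
  exists 0; apply/asboolP; exists [::], (fun=> msum (mspan [::]) K).
  by split=> //; split=> // i _; apply: FK.
have Qb k : Q k -> (k <= n)%N by move=> /asboolP[s [c [_ /bn]]].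
case: (ex_maxnP Q0 Qb) => p /asboolP[s [c [sL' Fc ec]]] pm; exists s => //.
apply: contrapT => nLs.
have [a [La nsa]] : exists a, L a /\ ~ msum (mspan s) K a.
  by apply: contrapT => na; apply: nLs => a La; apply: contrapT => nsa; apply: na; exists a.
have asL : [set` a :: s] `<=` L.
  by move=> z /=; rewrite inE => /orP[/eqP ->//|/sL'].
suff : (p.+1 <= p)%N by rewrite ltnn.
apply: pm; apply/asboolP; exists (a :: s).
have sas : msum (mspan s) K `<=` msum (mspan (a :: s)) K.
  apply: msumS => //; apply: smallest_sub; first exact: mspanP.
  by move=> z zs; apply: sub_gen_smallest; rewrite /= inE zs orbT.
eexists; split=> //; first apply: (strict_chain_rcons Fc (FK _ asL)).
  rewrite ec; split=> // /(_ a) h; apply/nsa/h; apply: msum_subl; first by case: sK.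
  by apply: sub_gen_smallest; rewrite /= mem_head.
by rewrite /= ltnn.
Qed.

End Submodules.

(** * Cohen-Macaulay localizations in dimension at most one *)

Section Ideals.
Variable R : comPzRingType.
Implicit Types I J K M P T : set R.

Lemma submodT I : submod setT I <-> ideal I.
Proof. by split=> -[I0 ID IM]; split=> // r a; [apply: IM|move=> _; apply: IM]. Qed.

Lemma idealB I a b : ideal I -> I a -> I b -> I (a - b).
Proof. by move=> iI Ia Ib; have [_ ID _] := iI; apply: ID => //; apply: idealN. Qed.

Lemma idealT : ideal (setT : set R).
Proof. by []. Qed.

Lemma ideal_mulr I r a : ideal I -> I a -> I (a * r).
Proof. by move=> [_ _ IM] Ia; rewrite mulrC; apply: IM. Qed.

Lemma ideal_eqT I : ideal I -> I 1 -> I = setT.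
Proof. by move=> [_ _ IM] I1; apply/seteqP; split=> // a _; rewrite -[a]mulr1; apply: IM. Qed.

Lemma ideal_gen_sub (X : set R) I : ideal I -> X `<=` I -> ideal_gen X `<=` I.
Proof. by move=> iI XI; apply: smallest_sub. Qed.

Lemma mem_ideal_gen (X : set R) a : X a -> ideal_gen X a.
Proof. by move=> Xa; apply: sub_gen_smallest. Qed.

Lemma ideal_gen_nil a : ideal_gen [set` ([::] : seq R)] a -> a = 0.
Proof.
apply: (@ideal_gen_sub _ [set 0]) => //; split=> // [x y -> ->|r x ->] /=.
  by rewrite addr0.
by rewrite mulr0.
Qed.

Definition adjoin I a : set R := [set z | exists r, I (z - r * a)].

Lemma adjoinP I a : ideal I -> ideal (adjoin I a).
Proof.
move=> iI; have [I0 ID IM] := iI; split.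
- by exists 0; rewrite mul0r subr0.
- move=> x y [r xr] [t yt]; exists (r + t).
  by rewrite mulrDl opprD addrACA; apply: ID.
- by move=> c x [r xr]; exists (c * r); rewrite -mulrA -mulrBr; apply: IM.
Qed.

Lemma sub_adjoin I a : I `<=` adjoin I a.
Proof. by move=> x Ix; exists 0; rewrite mul0r subr0. Qed.

Lemma mem_adjoin I a : ideal I -> adjoin I a a.
Proof. by move=> [I0 _ _]; exists 1; rewrite mul1r subrr. Qed.

Lemma adjoin_sub I J a : ideal J -> I `<=` J -> J a -> adjoin I a `<=` J.
Proof.
move=> [_ JD JM] IJ Ja x [r /IJ Jx]; rewrite -(subrK (r * a) x).
by apply: JD => //; apply: JM.
Qed.

Lemma ideal_avoiding K T : ideal K -> (forall a, K a -> ~ T a) ->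
  exists P, [/\ ideal P, K `<=` P, (forall a, P a -> ~ T a)
    & forall J, ideal J -> P `<=` J -> (forall a, J a -> ~ T a) -> J `<=` P].
Proof.
move=> iK KT.
(* Zorn is applied to the sets [X] whose union with [K] is an ideal missing [T], so that the empty
   chain causes no trouble: its union stands for [K] itself. *)
pose Q X := ideal (K `|` X) /\ (forall a, (K `|` X) a -> ~ T a).
have [F FQ tF|A [[iA AT] Amax]] := @Zorn_bigcup _ Q; last first.
  exists (K `|` A); split=> //.
  move=> J iJ AJ JT x Jx; apply: contrapT => nx; apply: (Amax J); last first.
    have -> // : Q J = (ideal J /\ forall a, J a -> ~ T a).
    by rewrite /Q setUidr// => a Ka; apply: AJ; left.
  split; first by move=> a Aa; apply: AJ; right.
  by move=> /(_ _ Jx) Ax; apply: nx; right.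
have [K0 KD KM] := iK; split; last first.
  by move=> a [/KT//|[X FX Xa]]; have [_ /(_ a (or_intror Xa))] := FQ X FX.
split; first by left.
- move=> a b [Ka|[X FX Xa]] [Kb|[Y FY Yb]].
  + by left; apply: KD.
  + have [[_ D _] _] := FQ _ FY.
    by have [] := D a b (or_introl Ka) (or_intror Yb); [left|right; exists Y].
  + have [[_ D _] _] := FQ _ FX.
    by have [] := D a b (or_intror Xa) (or_introl Kb); [left|right; exists X].
  + have [XY|YX] := tF _ _ FX FY.
      have [[_ D _] _] := FQ _ FY.
      by have [] := D a b (or_intror (XY _ Xa)) (or_intror Yb); [left|right; exists Y].
    have [[_ D _] _] := FQ _ FX.
    by have [] := D a b (or_intror Xa) (or_intror (YX _ Yb)); [left|right; exists X].
- move=> r a [Ka|[X FX Xa]]; first by left; apply: KM.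
  have [[_ _ M] _] := FQ _ FX.
  by have [] := M r a (or_intror Xa); [left|right; exists X].
Qed.

Lemma maximal_ideal_exists K : ideal K -> ~ K 1 ->
  exists2 M, maximal_ideal M & K `<=` M.
Proof.
move=> iK K1; have [|M [iM KM M1 Mm]] := @ideal_avoiding K [set 1] iK.
  by move=> a Ka e; apply: K1; rewrite -e.
exists M => //; split=> //; first by move=> MT; apply: (M1 1) => //; rewrite MT.
move=> J iJ MJ; have [J1|J1] := pselect (J 1); [right|left].
  exact: ideal_eqT.
by apply/seteqP; split=> //; apply: Mm => // a Ja e; apply: J1; rewrite -e.
Qed.

(** An ideal [P] maximal among those missing [T] is prime: if [a] and [b] are outside of [P], then
    adjoining them reaches some [t] and [u] in [T], and [a * b] in [P] would put [t * u] in [P]. *)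
Lemma prime_ideal_exists K T : ideal K -> T 1 ->
  (forall a b, T a -> T b -> T (a * b)) -> (forall a, K a -> ~ T a) ->
  exists P, [/\ prime_ideal P, K `<=` P & forall a, P a -> ~ T a].
Proof.
move=> iK T1 TM KT; have [P [iP KP PT Pm]] := ideal_avoiding iK KT.
exists P; split=> //; split=> //; first by move=> /PT.
have hit a : ~ P a -> exists2 t, T t & adjoin P a t.
  move=> nPa; apply: contrapT => nt; apply: nPa.
  apply: (Pm (adjoin P a)); [exact: adjoinP|exact: sub_adjoin| |exact: mem_adjoin].
  by move=> t at' Tt; apply: nt; exists t.
move=> a b Pab; apply: contrapT => /not_orP[/hit[t Tt [r tr]] /hit[u Tu [c uc]]].
have [_ PD PM] := iP; apply: (PT (t * u)); last exact: TM.
have -> : t * u = (t - r * a) * u + (r * a * (u - c * b) + r * c * (a * b)) by ring.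
by apply: (PD); [exact: ideal_mulr|apply: PD; exact: PM].
Qed.

Lemma maximal_prime M : maximal_ideal M -> prime_ideal M.
Proof.
move=> [iM MT Mm]; have M1 : ~ M 1 by move=> /(ideal_eqT iM).
split=> // a b Mab; apply: contrapT => /not_orP[na nb].
have [e|e] := Mm _ (adjoinP a iM) (@sub_adjoin M a).
  by apply: na; rewrite -e; apply: mem_adjoin.
have [r r1] : adjoin M a 1 by rewrite e.
apply: nb; have [_ MD MM] := iM.
have -> : b = (1 - r * a) * b + r * (a * b) by ring.
by apply: MD; [exact: ideal_mulr|exact: MM].
Qed.

Definition regular (a : R) := forall z, a * z = 0 -> z = 0.

Lemma regularX a k : regular a -> regular (a ^+ k).
Proof.
move=> ra; elim: k => [|k IHk] z; first by rewrite expr0 mul1r.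
by rewrite exprS -mulrA => /ra/IHk.
Qed.

End Ideals.

(** * Noetherian local rings of dimension and depth zero or one *)

Section LocalRing.
Variables (S : comPzRingType) (n : set S).
Hypotheses (S_noeth : noetherian S) (n_ideal : ideal n) (n1 : ~ n 1).
Hypothesis n_unit : forall y, ~ n y -> exists t, y * t = 1.
Implicit Types (P Q J : set S) (g : S) (s : seq S).

Lemma proper_sub_local J : ideal J -> ~ J 1 -> J `<=` n.
Proof.
move=> iJ J1 y Jy; apply: contrapT => /n_unit[t yt]; apply: J1.
by rewrite -yt; apply: ideal_mulr.
Qed.

Lemma local_ringP : local_ring n.
Proof.
have mn : maximal_ideal n.
  split=> //; first by move=> nT; apply: n1; rewrite nT.
  move=> J iJ nJ; have [J1|J1] := pselect (J 1); [right|left].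
    exact: ideal_eqT.
  by apply/seteqP; split=> //; exact: proper_sub_local.
split=> // M [iM MT Mm].
have [|//|nT] := Mm n n_ideal; last by case: n1; rewrite nT.
by apply: proper_sub_local => // /(ideal_eqT iM).
Qed.

Let prime_sub_n P : prime_ideal P -> P `<=` n.
Proof. by move=> [iP P1 _]; exact: proper_sub_local. Qed.

Let neq01 : (1 : S) <> 0.
Proof. by move=> e; apply: n1; rewrite e; case: n_ideal. Qed.

Lemma regular_avoided g : regular g -> exists2 P : set S, prime_ideal P & ~ P g.
Proof.
move=> rg; pose T := [set y | exists k : nat, y = g ^+ k].
have [|||a -> [k /esym e]|P [pP _ PT]] := @prime_ideal_exists S [set 0] T.
- by split=> // [x y -> ->|r x ->] /=; rewrite ?addr0 ?mulr0.
- by exists 0%N.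
- by move=> _ _ [i ->] [j ->]; exists (i + j)%N; rewrite exprD.
- by apply: neq01; apply: (regularX (a := g) (k := k)) => //; rewrite e mul0r.
- by exists P => // /PT; apply; exists 1%N; rewrite expr1.
Qed.

Lemma regular_seq1 g : n g -> regular g -> regular_sequence [:: g].
Proof.
move=> ng rg; split.
  by move=> /(ideal_gen_sub n_ideal) h; apply/n1/h => z /=; rewrite inE => /eqP ->.
move=> [|//] a _ /= /ideal_gen_nil/rg ->; by have [] := ideal_genP [set` ([::] : seq S)].
Qed.

Lemma regular_seq_head g s : regular_sequence (g :: s) -> regular g.
Proof.
move=> [_ /(_ 0%N _ isT) /= rs] z gz; apply: ideal_gen_nil; apply: rs; rewrite gz.
by have [] := ideal_genP [set` ([::] : seq S)].
Qed.

Lemma cm_local_dim0 : (forall P, prime_ideal P -> P = n) -> cm_local n.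
Proof.
move=> Pn; split=> //; first exact: local_ringP.
exists 0%N; split; split.
- by exists (fun=> n); split=> // i _; apply: maximal_prime; case: local_ringP.
- move=> [//|k] c [Pc Sc]; have [_] := Sc 0%N isT.
  by rewrite (Pn _ (Pc 0%N isT)) (Pn _ (Pc 1%N isT)); case.
- exists [::]; split=> //; split=> // /ideal_gen_nil; exact: neq01.
- move=> [//|g s] /regular_seq_head/regular_avoided[P /Pn -> ng] sn.
  by case: ng; apply: sn; rewrite /= mem_head.
Qed.

(** A prime missing [g] lies strictly below [n], which gives dimension one. Depth two is impossible:
    in a regular sequence [a], [b] some power of [b] would be a multiple of [a], and cancelling [b]
    would make [a] a unit. *)
Lemma cm_local_dim1 g : n g -> regular g ->
  (forall P Q, prime_ideal P -> prime_ideal Q -> P `<` Q -> Q = n) ->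
  cm_local n.
Proof.
move=> ng rg dim1; split=> //; first exact: local_ringP.
have bd k c : strict_chain (@prime_ideal S) k c -> (k <= 1)%N.
  case: k => [//|[//|k]] [Pc Sc]; have [_] := Sc 1%N isT.
  have -> : c 1%N = n by apply: (dim1 (c 0)); [exact: Pc|exact: Pc|exact: Sc].
  by case; apply: prime_sub_n; exact: Pc.
exists 1%N; split; split=> //.
- have [P pP nPg] := regular_avoided rg.
  exists (fun i => if (i <= 0)%N then P else n).
  apply: (@strict_chain_rcons _ _ 0 (fun=> P)) => //.
    by apply: maximal_prime; case: local_ringP.
  by split; [exact: prime_sub_n|move=> /(_ _ ng)].
- by exists [:: g]; split=> //; [exact: regular_seq1|move=> z /=; rewrite inE => /eqP ->].
move=> [//|a [//|b s]] rs sn; exfalso.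
have ra := regular_seq_head rs.
have nb : n b by apply: sn; rewrite /= !inE eqxx orbT.
have na : n a by apply: sn; rewrite /= mem_head.
(* A regular element avoids non-maximal primes: the products [s * a ^+ k] with [s] outside of [P]
   are nonzero, so some prime misses them all and lies strictly below [P]. *)
have over P : prime_ideal P -> P a -> P = n.
  move=> pP Pa; have [iP P1 PM] := pP.
  pose T := [set y : S | exists (s : S) (k : nat), ~ P s /\ y = s * a ^+ k].
  have [|||y -> [u [k [nPu /esym e]]]|Q [pQ _ QT]] := @prime_ideal_exists S [set 0] T.
  - by split=> // [x y -> ->|r x ->] /=; rewrite ?addr0 ?mulr0.
  - by exists 1, 0%N; rewrite mul1r.
  - move=> _ _ [u [i [nPu ->]]] [v [j [nPv ->]]]; exists (u * v), (i + j)%N.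
    by split; [case/PM|rewrite exprD; ring].
  - apply: nPu; have -> : u = 0.
      by apply: (regularX (a := a) (k := k)) => //; rewrite mulrC.
    by case: iP.
  apply: (dim1 Q P) => //; split.
    move=> q Qq; apply: contrapT => nPq; apply: (QT q Qq); exists q, 0%N.
    by rewrite mulr1.
  by move=> /(_ _ Pa) Qa; apply: (QT a Qa); exists 1, 1%N; rewrite mul1r.
(* The only prime containing [a] is [n], and [n] contains [b]. *)
have [k bk] : exists k : nat, ideal_gen [set` [:: a]] (b ^+ k).
  apply: contrapT => nk.
  have [|||x ax [k ex]|P [pP aP PT]] :=
    @prime_ideal_exists S (ideal_gen [set` [:: a]]) [set y | exists k : nat, y = b ^+ k].
  - exact: ideal_genP.
  - by exists 0%N.
  - by move=> _ _ [i ->] [j ->]; exists (i + j)%N; rewrite exprD.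
  - by apply: nk; exists k; rewrite -ex.
  have Pa : P a by apply: aP; apply: mem_ideal_gen; rewrite /= mem_head.
  by apply: (PT b); [rewrite (over P)|exists 1%N; rewrite expr1].
have a1 : ideal_gen [set` [:: a]] 1.
  case: rs => _ /(_ 1%N _ isT) /= rb; elim: k bk => [//|k IHk].
  by rewrite exprS => /rb/IHk.
by apply/n1/(ideal_gen_sub n_ideal _ a1) => z /=; rewrite inE => /eqP ->.
Qed.

End LocalRing.

(** * Transfer of primes, regularity and finite generation to a localization *)

Section Localization.
Variables (R S : comPzRingType) (M : set R) (f : {rmorphism R -> S}).
Hypotheses (R_noeth : noetherian R) (M_max : maximal_ideal M).
Hypothesis f_loc : is_localization_at M f.
Implicit Types P Q : set S.

Let M_prime : prime_ideal M. Proof. exact: maximal_prime. Qed.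

Definition loc_max : set S := [set y | exists a s, [/\ M a, ~ M s & y * f s = f a]].

Lemma loc_max_unit y : ~ loc_max y -> exists t, y * t = 1.
Proof.
case: f_loc => l1 l2 _ ny; have [a [s [ns e]]] := l2 y.
have [|t ft] := l1 a; first by move=> Ma; apply: ny; exists a, s.
by exists (f s * t); rewrite mulrA e.
Qed.

Lemma loc_maxP : ideal loc_max.
Proof.
case: f_loc => _ l2 _; have [[M0 MD MM] M1 Mp] := M_prime; split.
- by exists 0, 1; rewrite mul0r rmorph0.
- move=> y z [a [s [Ma ns e]]] [b [t [Mb nt e']]].
  exists (t * a + s * b), (s * t); split; first by apply: MD; apply: MM.
    by case/Mp.
  by rewrite !(rmorphD, rmorphM) -e -e'; ring.
- move=> r y [a [s [Ma ns e]]]; have [c [u [nu e']]] := l2 r.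
  exists (c * a), (u * s); split; [exact: MM|by case/Mp|].
  by rewrite !rmorphM -e -e'; ring.
Qed.

Lemma loc_max1 : ~ loc_max 1.
Proof.
move=> [a [s [Ma ns]]]; rewrite mul1r => e.
case: f_loc => _ _ /(_ _ _ e) [u [nu e']].
have [[_ _ MM] _ Mp] := M_prime; have : M (u * s) by rewrite e'; apply: MM.
by case/Mp.
Qed.

Lemma loc_max_f a : M a -> loc_max (f a).
Proof. by move=> Ma; exists a, 1; rewrite rmorph1 mulr1; split=> //; case: M_prime. Qed.

Lemma contract_prime P : prime_ideal P -> prime_ideal (f @^-1` P).
Proof.
move=> [[P0 PD PM] P1 Pp]; split; last by move=> a b /=; rewrite rmorphM => /Pp.
  split=> [|a b|r a] /=; rewrite ?rmorph0 ?rmorphD ?rmorphM //; [exact: PD|exact: PM].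
by rewrite /= rmorph1.
Qed.

Lemma contract_sub P : prime_ideal P -> f @^-1` P `<=` M.
Proof.
move=> [iP P1 _] a Pa; apply: contrapT => na; case: f_loc => /(_ _ na)[t ft] _ _.
by apply: P1; rewrite -ft; apply: ideal_mulr.
Qed.

Lemma contract_proper P Q : prime_ideal P -> prime_ideal Q -> P `<` Q ->
  f @^-1` P `<` f @^-1` Q.
Proof.
move=> pP pQ [PQ nQP]; split; first by move=> a; apply: PQ.
move=> QP; apply: nQP => y Qy; case: f_loc => _ /(_ y)[a [s [ns e]]] _.
have [iQ _ _] := pQ; have [_ _ Pp] := pP.
have /Pp[//|Ps] : P (y * f s) by rewrite e; apply: QP; rewrite /= -e; apply: ideal_mulr.
by case: ns; apply: (contract_sub pP).
Qed.

Lemma regular_localized g : regular g -> regular (f g).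
Proof.
move=> rg y gy; case: f_loc => l1 /(_ y)[a [s [ns e]]] l3.
have [|u [nu]] := l3 (a * g) 0; first by rewrite rmorph0 rmorphM -e mulrAC [y * _]mulrC gy mul0r.
rewrite mulr0 mulrA [u * a * g]mulrC => /rg ua.
have [t ut] := l1 _ nu; have [t' st] := l1 _ ns.
have a0 : f a = 0.
  by rewrite -[f a]mulr1 -ut mulrA [f a * _]mulrC -rmorphM ua rmorph0 mul0r.
by rewrite -[y]mulr1 -st mulrA e a0 mul0r.
Qed.

Lemma noetherian_localized : noetherian S.
Proof.
move=> J iJ; have [J0 JD JM] := iJ.
have [|s es] := R_noeth (I := f @^-1` J).
  by split=> [|a b|r a] /=; rewrite ?rmorph0 ?rmorphD ?rmorphM //; [exact: JD|exact: JM].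
have iG := ideal_genP [set` map f s]; have [G0 GD GM] := iG.
exists (map f s); apply/seteqP; split; last first.
  apply: ideal_gen_sub => // _ /= /mapP[a sa ->].
  by have : (f @^-1` J) a by rewrite es; apply: mem_ideal_gen.
move=> y Jy; case: f_loc => l1 /(_ y)[a [u [nu e]]] _.
have : (f @^-1` J) a by rewrite /= -e; apply: ideal_mulr.
have iF : ideal (f @^-1` ideal_gen [set` map f s]).
  by split=> [|b c|r b] /=; rewrite ?rmorph0 ?rmorphD ?rmorphM //; [exact: GD|exact: GM].
rewrite es => /(ideal_gen_sub iF) fa; have [t ut] := l1 _ nu.
have -> : y = f a * t by rewrite -e -mulrA ut mulr1.
apply: (ideal_mulr t iG); apply: fa => b sb.
by apply: mem_ideal_gen; apply/mapP; exists b.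
Qed.

(** Chains of primes of [S] contract to chains below [M]. If [M] is not minimal, then [g] stays
    regular in [S] and gives depth one; if [M] is minimal, then [loc_max] is the only prime of
    [S]. *)
Lemma cm_localization :
  (forall P Q : set R, prime_ideal P -> prime_ideal Q -> P `<` Q -> maximal_ideal Q) ->
  (forall P : set R, prime_ideal P -> P `<` M -> exists2 g, M g & regular g) ->
  exists n : set S, cm_local n.
Proof.
move=> dim1 reg; exists loc_max.
have cm1 := cm_local_dim1 noetherian_localized loc_maxP loc_max1 loc_max_unit.
have cm0 := cm_local_dim0 noetherian_localized loc_maxP loc_max1 loc_max_unit.
have sub P : prime_ideal P -> P `<=` loc_max.
  by move=> [iP P1 _]; apply: proper_sub_local => //; exact: loc_max_unit.
have max P : prime_ideal P -> M `<=` f @^-1` P -> loc_max `<=` P.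
  move=> [iP _ _] MP y [a [s [Ma ns e]]]; case: f_loc => /(_ _ ns)[t st] _ _.
  by rewrite -[y]mulr1 -st mulrA e; apply: ideal_mulr => //; exact: MP.
have [[P pP PM]|nP] := pselect (exists2 P : set R, prime_ideal P & P `<` M).
  have [g Mg rg] := reg P pP PM.
  apply: (cm1 (f g)); [exact: loc_max_f|exact: regular_localized|].
  move=> P' Q pP' pQ P'Q; apply/seteqP; split; first exact: sub.
  have [_ _ Qm] := dim1 _ _ (contract_prime pP') (contract_prime pQ)
    (contract_proper pP' pQ P'Q).
  apply: max => //; have [iM M1 _] := M_prime.
  by have [->|MT] := Qm M iM (contract_sub pQ); last by case: M1; rewrite MT.
apply: cm0 => P pP; apply/seteqP; split; first exact: sub.
apply: max => //; apply: contrapT => nMP; apply: nP; exists (f @^-1` P).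
  exact: contract_prime.
by split=> //; exact: contract_sub.
Qed.

End Localization.

(** * Filtered rings with bounded Hilbert function *)

Section FilteredRing.
Variable R : comPzRingType.

(* The index is shifted by one: [F n] plays the role of the elements of degree
   less than [n], so that [F 1] is the ring of scalars. *)
Record filtration (F : nat -> set R) (C : nat) : Prop := Filtration {
  fil_0 : forall a, F 0%N a -> a = 0;
  fil_1 : F 1%N 1;
  fil_zero : forall n, F n 0;
  fil_add : forall n a b, F n a -> F n b -> F n (a + b);
  fil_opp : forall n a, F n a -> F n (- a);
  fil_S : forall n, F n `<=` F n.+1;
  fil_mul : forall n p a b, F n.+1 a -> F p.+1 b -> F (n + p).+1 (a * b);
  fil_cover : forall a, exists n, F n a;
  fil_len : forall n, len_le (F 1%N) (F n.+1) (F n) C }.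

Variables (F : nat -> set R) (C : nat).
Hypothesis filF : filtration F C.
Implicit Types (P Q J K L : set R).

Let F1N : F 1%N (-1).
Proof. by apply: fil_opp; [exact: filF|exact: fil_1 filF]. Qed.

Lemma fil_submod n : submod (F 1%N) (F n).
Proof.
split; [exact: fil_zero filF n|exact: fil_add filF n|].
case: n => [|n] r a Fr Fa; last exact: (fil_mul filF Fr Fa).
by rewrite (fil_0 filF Fa) mulr0; exact: fil_zero filF 0%N.
Qed.

Lemma ideal_submod (Phi J : set R) : ideal J -> submod Phi J.
Proof. by move=> [J0 JD JM]; split=> // r a _; apply: JM. Qed.

Lemma fil_le n p : (n <= p)%N -> F n `<=` F p.
Proof.
move=> /subnKC <-; elim: (p - n)%N => [|k IHk]; first by rewrite addn0.
by rewrite addnS; apply: subset_trans IHk _; exact: fil_S filF _.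
Qed.

(** Cutting with [F n.+1] keeps a chain strict: every member contains [K], and modulo [K] each
    element has a representative in [F n.+1]. *)
Lemma fil_len_quot K n : ideal K ->
  len_le (F 1%N) (msum (F n.+1) K) (msum (F n) K) C.
Proof.
move=> iK k c hc.
have h := @strict_chain_map _ _ _ (mitv (F 1%N) (F n.+1) (F n))
  (fun L => L `&` F n.+1) k c _ _ hc.
apply: (@fil_len F C filF n); apply: h.
  move=> L [sL KL LF]; split; first by apply: submod_cap => //; exact: fil_submod.
    move=> a Fa; split; last exact: (fil_S filF).
    by apply/KL/msum_subl => //; case: iK.
  by move=> a [].
move=> L L' [sL KL LF] [sL' KL' LF'] [LL nLL]; split; first exact: setSI.
move=> hS; apply: nLL => a La; have [b Fb Kab] := LF' _ La.
have Lab : L (a - b).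
  by apply/KL/msum_subr => //; exact: fil_zero filF n.
have [|Lb _] := hS b.
  by split=> //; rewrite -(subKr a b); apply: (submodB F1N sL') => //; exact: LL.
by rewrite -(subrK b a); case: sL => _ LD _; apply: LD.
Qed.

Lemma fil_len_shift K n s : ideal K ->
  len_le (F 1%N) (msum (F (n + s)%N) K) (msum (F n) K) (C * s)%N.
Proof.
move=> iK; have sK := ideal_submod (F 1%N) iK.
have sM p : submod (F 1%N) (msum (F p) K) by apply: submod_msum => //; exact: fil_submod.
elim: s => [|s IHs]; first by rewrite addn0 muln0; apply/len_len_le/lenxx.
rewrite addnS mulnSr; apply: (len_le_add F1N (sM (n + s)%N%N)) => //.
- by apply: msumS => //; apply: fil_le; exact: leq_addr.
- by apply: msumS => //; exact: fil_S filF _.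
- exact: fil_len_quot.
Qed.

Lemma fil_len_mod K n : ideal K -> len_le (F 1%N) (msum (F n) K) K (C * n)%N.
Proof.
move=> iK; have := @fil_len_shift K 0%N n iK; rewrite add0n; apply: len_le_sub => //.
apply: (@msum_sub _ (F 1%N)) => //; first exact: ideal_submod.
by move=> a /(fil_0 filF) ->; case: iK.
Qed.

Lemma fil_mulS n s f a : F s.+1 f -> F n a -> F (n + s)%N (f * a).
Proof.
case: n => [|n] Ff Fa; last by rewrite addSn addnC; exact: (fil_mul filF).
by rewrite (fil_0 filF Fa) mulr0; exact: fil_zero filF _.
Qed.

(* Multiplication by [f] embeds [F n] into [F (n + s)] modulo [P], while the
   lengths of these two modules differ by at most [C * s]. *)
Lemma len_mod_prime_mul P f s n : prime_ideal P -> ~ P f -> F s.+1 f ->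
  len_le (F 1%N) (msum (F (n + s)%N) P)
    (msum [set f * a | a in F n] P) (C * s)%N.
Proof.
move=> [iP P1 Pp] nPf Ff; have [P0 PD PM] := iP; have sP := ideal_submod (F 1%N) iP.
have sM p : submod (F 1%N) (msum (F p) P) by apply: submod_msum => //; exact: fil_submod.
have PF p : P `<=` msum (F p) P by apply: msum_subr; exact: fil_zero filF p.
pose fX (X : set R) := msum [set f * a | a in X] P.
have sfX X : submod (F 1%N) X -> submod (F 1%N) (fX X).
  move=> [X0 XD XM]; apply: submod_msum => //; split.
  - by exists 0 => //; rewrite mulr0.
  - by move=> _ _ [a Xa <-] [b Xb <-]; exists (a + b); [exact: XD|rewrite mulrDr].
  - by move=> r _ Fr [a Xa <-]; exists (r * a); [exact: XM|rewrite mulrCA].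
have PfX (X : set R) : X 0 -> P `<=` fX X.
  by move=> X0; apply: msum_subr; exists 0; rewrite ?mulr0.
have fXF : fX (F n) `<=` msum (F (n + s)%N) P.
  by apply: msumS => // _ [a Fa <-]; exact: fil_mulS.
have [p _ lp] := len_exists sP (@PF n) (@fil_len_mod P n iP).
have [q _ lq] := len_exists sP (@PF (n + s)%N) (@fil_len_mod P (n + s)%N iP).
have [p' [r [lp' lr eq]]] := len_split F1N (sfX _ (fil_submod n)) sP (sM (n + s)%N%N)
  (PfX _ (fil_zero filF n)) fXF lq.
have [p2 [r2 [lp2 /len_ler/(_ (@fil_len_shift P n s iP)) r2s eq2]]] :=
  len_split F1N (sM n) sP (sM (n + s)%N%N) (@PF n)
  (msumS (fil_le (leq_addr s n)) (@subset_refl _ P)) lq.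
(* Multiplication by [f] is injective modulo the prime [P], so it keeps chains strict. Then [r] is
   at most [r2], since [p' + r] and [p + r2] both equal [q]. *)
have pp' : (p <= p')%N.
  apply: len_ler lp _ => k c hc.
  have h := @strict_chain_map _ _ _ (mitv (F 1%N) (fX (F n)) P) fX k c _ _ hc.
  apply: (len_len_le lp'); apply: h.
    move=> L [sL PL LF]; split; [exact: sfX|by apply: PfX; case: sL|].
    move=> z [_ [a /LF [b Fb Pab] <-] Pz]; exists (f * b); first by exists b.
    have -> : z - f * b = z - f * a + f * (a - b) by ring.
    by apply: PD => //; apply: PM.
  move=> L L' [sL PL LF] [sL' PL' LF'] [LL nLL]; split.
    by apply: msumS => // _ [a La <-]; exists a => //; exact: LL.
  move=> hS; apply: nLL => a La.
  have [_ [b Lb <-]] : fX L (f * a) by apply/hS/msum_subl => //; exists a.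
  rewrite -mulrBr => /Pp[//|/PL Lab].
  by rewrite -(subrK b a); case: sL => _ LD _; apply: LD.
apply: len_leW (len_len_le lr); have := len_uniq lp lp2; lia.
Qed.

(** The strict inclusions of a chain have witnesses in a common [F N]. Cutting with [F (N + s)]
    modulo [P] keeps the chain strict, and the bound [C * s] there does not depend on [N]. *)
Lemma len_prime_adjoin P f s : prime_ideal P -> ~ P f -> F s.+1 f ->
  len_le (F 1%N) setT (adjoin P f) (C * s)%N.
Proof.
move=> pP nPf Ff k c [Fc Sc]; have [iP _ _] := pP.
have [N hN] : exists N, forall i, (i < k)%N -> exists a, [/\ c i.+1 a, ~ c i a & F N a].
  elim: {Fc} k Sc => [|k IHk] Sc; first by exists 0%N.
  have [i ik|N hN] := IHk; first exact/Sc/ltnW.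
  have [_ nk] := Sc k (ltnSn k).
  have [a [ca nca]] : exists a, c k.+1 a /\ ~ c k a.
    by apply: contrapT => na; apply: nk => a ca; apply: contrapT => nca; apply: na; exists a.
  have [p Fp] := fil_cover filF a; exists (maxn N p) => i.
  rewrite ltnS leq_eqVlt => /orP[/eqP ->|/hN[b [? ? Fb]]].
    by exists a; split=> //; apply: fil_le Fp; exact: leq_maxr.
  by exists b; split=> //; apply: fil_le Fb; exact: leq_maxl.
have sM : submod (F 1%N) (msum (F (N + s)%N) P).
  by apply: submod_msum; [exact: fil_submod|exact: ideal_submod].
apply: (@len_mod_prime_mul P f s N pP nPf Ff k (fun i => c i `&` msum (F (N + s)%N) P)).
split=> i ik.
  have [sc Pc _] := Fc i ik; split; first exact: submod_cap.
    move=> z [_ [a Fa <-] Pz]; split; first by apply: Pc; exists a; rewrite [a * f]mulrC.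
    by exists (f * a) => //; exact: fil_mulS.
  by move=> z [].
have [cS _] := Sc i ik; split; first exact: setSI.
have [a [ca nca Fa]] := hN i ik; move=> h; have [|//] := h a.
split=> //; apply: msum_subl; first by case: iP.
by apply: fil_le Fa; exact: leq_addr.
Qed.

(** A domain of finite length is a field: modulo [Q] the ideals of the powers of [a] cannot decrease
    strictly forever, and [a ^+ i] being a multiple of [a ^+ i.+1] makes [a] invertible. *)
Lemma prime_maximal Q B : prime_ideal Q -> len_le (F 1%N) setT Q B -> maximal_ideal Q.
Proof.
move=> [iQ Q1 Qp] bQ; split=> //; first by move=> QT; apply: Q1; rewrite QT.
move=> J iJ QJ; have [JQ|nJQ] := pselect (J `<=` Q); first by left; apply/seteqP.
right; apply: ideal_eqT => //.
have [a [Ja nQa]] : exists a, J a /\ ~ Q a.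
  by apply: contrapT => na; apply: nJQ => a Ja; apply: contrapT => ?; apply: na; exists a.
have [[i ai]|nai] := pselect (exists i : nat, adjoin Q (a ^+ i.+1) (a ^+ i)).
  case: ai => r; rewrite exprS mulrA -{1}[a ^+ i]mul1r -mulrBl => /Qp[Q1ra|Qa].
    by rewrite -(subrK (r * a) 1); case: (iJ) => _ JD JM; apply: JD; [exact: QJ|exact: JM].
  by case: nQa; elim: i Qa => [//|i IHi]; rewrite exprS => /Qp[].
suff /bQ : strict_chain (mitv (F 1%N) setT Q) B.+1
    (fun i => adjoin Q (a ^+ (B.+1 - i))) by rewrite ltnn.
split=> i ik; first by split=> //; [exact/ideal_submod/adjoinP|exact: sub_adjoin].
rewrite -(subnSK ik); split.
  apply: adjoin_sub; [exact: adjoinP|exact: sub_adjoin|rewrite exprS].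
  by have [_ _ M] := adjoinP (a ^+ (B.+1 - i.+1)) iQ; apply/M/mem_adjoin.
by move=> h; apply: nai; exists (B.+1 - i.+1)%N; apply/h/mem_adjoin.
Qed.

Lemma len_le_prime P Q : prime_ideal P -> prime_ideal Q -> P `<` Q ->
  exists B, len_le (F 1%N) setT Q B.
Proof.
move=> pP [iQ _ _] [PQ nQP].
have [f [Qf nPf]] : exists a, Q a /\ ~ P a.
  by apply: contrapT => na; apply: nQP => a ?; apply: contrapT => ?; apply: na; exists a.
have [s Ff] := fil_cover filF f; exists (C * s)%N.
apply: len_le_sub (len_prime_adjoin pP nPf (fil_S filF Ff)) => //.
exact: adjoin_sub.
Qed.

(** * Filtered rings generated in large degrees by one element of degree one *)

Section Generator.
Variables (x : R) (N0 : nat).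
Hypothesis Fx : F 2%N x.
Hypothesis fil_gen : forall n a, (N0 <= n)%N -> F n.+2 a ->
  exists b c, [/\ F n.+1 b, F n.+1 c & a = x * b + c].

Let FxX i : F i.+1 (x ^+ i).
Proof.
elim: i => [|i IHi]; first by rewrite expr0; exact: fil_1 filF.
by rewrite exprS; exact: (fil_mul filF Fx IHi).
Qed.

Let FxM i n a : F n a -> F (n + i)%N (x ^+ i * a).
Proof. exact: fil_mulS. Qed.

Let fil_genX j a : F (N0.+1 + j)%N a ->
  exists b c, [/\ F N0.+1 b, F (N0 + j)%N c & a = x ^+ j * b + c].
Proof.
elim: j a => [|j IHj] a.
  rewrite addn0 => Fa; exists a, 0; split=> //; first exact: fil_zero filF _.
  by rewrite expr0 mul1r addr0.
rewrite addnS addSn => /(fil_gen (leq_addr j N0))[a' [c [Fa' Fc ->]]].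
have [b [c' [Fb Fc' ->]]] := IHj a' Fa'.
exists b, (x * c' + c); split=> //; last by rewrite exprS; ring.
rewrite addnS; apply: (fil_add filF) => //.
by rewrite -addn1; exact: (FxM 1%N).
Qed.

(** Hilbert's basis argument: up to lower terms, an element of large degree is a power of [x] times
    an element of [F N0.+1], so leading coefficients live in the quotient of [F N0.+1] by [F N0], of
    bounded length. *)
Lemma filtered_noetherian : noetherian R.
Proof.
move=> J iJ; have [J0 JD JM] := iJ; have sJ := ideal_submod (F 1%N) iJ.
(* The leading coefficients [a] for which [x ^+ n * a] plus lower terms lies in [J]. They increase
   with [n], and finite generation of their union makes them stop at some [N]. *)
pose Ln n := [set a | F N0.+1 a /\ exists2 b, F (N0 + n)%N b & J (x ^+ n * a - b)].
have sLn n : submod (F 1%N) (Ln n).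
  have [z0 zD zM] := fil_submod N0.+1; split.
  - split=> //; exists 0; first exact: fil_zero filF _.
    by rewrite mulr0 subr0.
  - move=> a b [Fa [u Fu Ju]] [Fb [v Fv Jv]]; split; first exact: zD.
    exists (u + v); first exact: (fil_add filF).
    by rewrite mulrDr opprD addrACA; apply: JD.
  - move=> r a Fr [Fa [u Fu Ju]]; split; first exact: zM.
    exists (r * u); first by have [_ _] := fil_submod (N0 + n)%N; apply.
    by rewrite mulrCA -mulrBr; apply: JM.
have LnS n p : (n <= p)%N -> Ln n `<=` Ln p.
  move=> /subnKC <- a [Fa [b Fb Jab]]; split=> //; exists (x ^+ (p - n) * b).
    by rewrite addnA; exact: FxM.
  by rewrite addnC exprD -mulrA -mulrBr; apply: JM.
pose L := [set a | exists n, Ln n a].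
have sL : submod (F 1%N) L.
  split; first by exists 0%N; case: (sLn 0%N).
    move=> a b [n Ha] [p Hb]; exists (maxn n p); have [_ D _] := sLn (maxn n p).
    by apply: D; [exact: LnS (leq_maxl _ _) _ Ha|exact: LnS (leq_maxr _ _) _ Hb].
  by move=> r a Fr [n Ha]; exists n; have [_ _] := sLn n; apply.
have FLn n : F N0 `<=` Ln n.
  move=> a Fa; split; first exact: (fil_S filF).
  by exists (x ^+ n * a); [exact: FxM|rewrite subrr].
have iL : mitv (F 1%N) (F N0.+1) (F N0) L.
  by split=> // a; [move=> ?; exists 0%N; exact: FLn|move=> [n []]].
have [s sub_s Ls] := len_le_fg (fil_submod N0) (fil_len filF (n := N0)) iL.
have [N sN] : exists N, [set` s] `<=` Ln N.
  elim: {Ls} s sub_s => [|a s IHs] sub_s; first by exists 0%N.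
  have [|N hN] := IHs; first by move=> b sb; apply: sub_s; rewrite /= inE sb orbT.
  have [p Ha] : L a by apply: sub_s; rewrite /= mem_head.
  exists (maxn N p) => b /=; rewrite inE => /orP[/eqP ->|/hN].
    exact: LnS (leq_maxr _ _) _ Ha.
  by apply: LnS; exact: leq_maxl.
have LN : L `<=` Ln N.
  by apply: subset_trans Ls _; apply: (@msum_sub _ (F 1%N)) => //; exact: smallest_sub.
pose q := (N0.+1 + N)%N.
have bq : len_le (F 1%N) (F q) (F 0%N) (C * q)%N.
  apply: len_le_sub (@fil_len_mod [set 0] q _) => [||].
  - exact: msum_subl.
  - by move=> z ->; exact: fil_zero filF _.
  - by split=> // [u v -> ->|r u ->] /=; rewrite ?addr0 ?mulr0.
have [t tJ Jt] : exists2 t : seq R, [set` t] `<=` J `&` F q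
    & J `&` F q `<=` msum (mspan (F 1%N) t) (F 0%N).
  apply: (len_le_fg (fil_submod 0%N) bq); split.
  - by apply: submod_cap => //; exact: fil_submod.
  - by move=> a /(fil_0 filF) ->; split=> //; exact: fil_zero filF _.
  - by move=> a [].
have iT := ideal_genP [set` t]; have [T0 TD TM] := iT.
have Jq a : J a -> F q a -> ideal_gen [set` t] a.
  move=> Ja Fa; have [b tb /(fil_0 filF)/eqP] := Jt a (conj Ja Fa).
  rewrite subr_eq0 => /eqP ->; apply: smallest_sub tb; first exact: ideal_submod.
  by move=> c tc; apply: mem_ideal_gen.
exists t; apply/seteqP; split; last first.
  by apply: ideal_gen_sub => // a /tJ[].
suff main n a : J a -> F n a -> ideal_gen [set` t] a.
  by move=> a Ja; have [n Fa] := fil_cover filF a; exact: main Fa.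
elim: n a => [|n IHn] a Ja Fa; first by apply: Jq => //; exact: fil_le Fa.
have [nq|qn] := leqP n.+1 q; first by apply: Jq => //; exact: fil_le Fa.
have [j [en Nj]] : exists j, n = (N0 + j)%N /\ (N < j)%N.
  by exists (n - N0)%N; rewrite /q in qn; lia.
have [|b [c [Fb Fc ea]]] := fil_genX (j := j) (a := a).
  by rewrite addSn -en.
have [_ [d Fd Jd]] : Ln N b.
  apply: LN; exists j; split=> //; exists (- c); first exact: (fil_opp filF).
  by rewrite opprK -ea.
(* The second summand is a multiple of an element of [J] in [F q] and cancels the leading part of
   [a]; the first one lies in [F n], where induction applies. *)
have -> : a = (c + x ^+ (j - N) * d) + x ^+ (j - N) * (x ^+ N * b - d).
  rewrite ea -{1}(subnK (ltnW Nj)) exprD; ring.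
have Td : ideal_gen [set` t] (x ^+ N * b - d).
  apply: Jq => //; apply: (fil_add filF); first exact: FxM.
  by apply: (fil_opp filF); apply: fil_le Fd; rewrite /q; lia.
apply: TD; last exact: TM.
apply: IHn.
  have -> : c + x ^+ (j - N) * d = a - x ^+ (j - N) * (x ^+ N * b - d).
    rewrite ea -{2}(subnK (ltnW Nj)) exprD; ring.
  by apply: idealB => //; apply: JM.
rewrite en; apply: (fil_add filF) => //.
have -> : (N0 + j)%N = (N0 + N + (j - N))%N by lia.
exact: FxM.
Qed.

(** As [M] has a quotient of finite length, [x ^+ i] is congruent modulo [M] to some [b] of degree
    less than [i]. Their difference is regular: [x ^+ i * a = b * a] lowers the degree of [a]
    repeatedly until [a = 0]. *)
Lemma filtered_regular M P : (forall n a, F n.+1 (x * a) -> F n a) ->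
  maximal_ideal M -> prime_ideal P -> P `<` M -> exists2 g, M g & regular g.
Proof.
move=> reg mM pP PM; have pM := maximal_prime mM; have [iM _ _] := pM.
have [B bB] := len_le_prime pP pM PM.
have sM n : submod (F 1%N) (msum (F n) M).
  by apply: submod_msum; [exact: fil_submod|exact: ideal_submod].
have [i xi] : exists i, msum (F i) M (x ^+ i).
  apply: contrapT => ni.
  suff /bB : strict_chain (mitv (F 1%N) setT M) B.+1 (fun i => msum (F i) M).
    by rewrite ltnn.
  split=> i _; first by split=> //; apply: msum_subr; exact: fil_zero filF i.
  split; first by apply: msumS => //; exact: fil_S filF i.
  move=> h; apply: ni; exists i; apply/h/msum_subl; last exact: FxX.
  by case: iM.
have [b Fb Mg] := xi; exists (x ^+ i - b) => // a.
move=> /eqP; rewrite mulrBl subr_eq0 => /eqP ea.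
have regX j n : F (n + j)%N (x ^+ j * a) -> F n a.
  elim: j n => [|j IHj] n; first by rewrite addn0 expr0 mul1r.
  by rewrite exprS -mulrA addnS => /reg/IHj.
have [n Fa] := fil_cover filF a.
elim: n Fa => [|n IHn] Fa; first exact: (fil_0 filF).
apply/IHn/(regX i); rewrite ea; case: i {xi Mg ea regX} Fb => [|i] Fb.
  by rewrite (fil_0 filF Fb) mul0r; exact: fil_zero filF _.
by rewrite addnC addSn; exact: (fil_mul filF).
Qed.

Lemma filtered_cohen_macaulay :
  (forall n a, F n.+1 (x * a) -> F n a) \/ (exists N, forall a, F N a) ->
  cohen_macaulay R.
Proof.
move=> hF; split; first exact: filtered_noetherian.
have dim1 P Q : prime_ideal P -> prime_ideal Q -> P `<` Q -> maximal_ideal Q.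
  by move=> pP pQ /len_le_prime[]// B; apply: prime_maximal.
move=> M mM S f fM; apply: (cm_localization filtered_noetherian mM fM dim1).
move=> P pP PM; case: hF => [reg|[N FT]]; first exact: filtered_regular PM.
have [iP _ _] := pP.
(* The filtration stops at [N], so the quotient by [P] already has finite length and [P] cannot lie
   strictly below [M]. *)
have /(prime_maximal pP)[_ _ Pm] : len_le (F 1%N) setT P (C * N).
  by apply: len_le_sub (@fil_len_mod P N iP) => // a _; apply: msum_subl; case: iP.
have [[iM MT _] [sPM nMP]] := (mM, PM).
by case: (Pm M iM sPM) => // e; case: nMP; rewrite e.
Qed.

End Generator.

End FilteredRing.

(** * Existence of a principal reduction *)

Section Reduction.
Variables (A : comPzRingType) (m I : set A).
Hypotheses (A_noeth : noetherian A) (A_loc : local_ring m).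
Hypotheses (A_res : infinite_residue_field m) (I_ideal : ideal I) (Im : I `<=` m).
Implicit Types (B J K M N : set A) (Q : nat -> set A).
Local Notation E := (ideal_exp I).

Lemma local_unit a : ~ m a -> exists r, r * a = 1.
Proof.
move=> nma; have i0 : ideal [set (0 : A)].
  by split=> // [x y -> ->|r x ->] /=; rewrite ?addr0 ?mulr0.
have [[r]|n1] := pselect (adjoin [set 0] a 1).
  by move=> /= /eqP; rewrite subr_eq0 => /eqP e; exists r.
have [M mM aM] := maximal_ideal_exists (adjoinP a i0) n1.
by case: nma; rewrite -(A_loc.2 M mM); apply/aM/mem_adjoin.
Qed.

Lemma local_maximal : maximal_ideal m. Proof. by case: A_loc. Qed.

(* If [b] avoids all but the last of the subideals, all but finitely many of
   the [a + c * b], up to residue class of [c], avoid all of them. *)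
Lemma ideal_avoidance t (B : nat -> set A) :
  (forall i, (i < t)%N -> ideal (B i) /\ ~ (I `<=` B i)) ->
  exists2 y, I y & forall i, (i < t)%N -> ~ B i y.
Proof.
elim: t => [|t IHt] hB; first by exists 0 => //; case: I_ideal.
have [i it|b Ib nb] := IHt; first exact/hB/ltnW.
have [Bt_b|nBt_b] := pselect (B t b); last first.
  exists b => // i; rewrite ltnS leq_eqVlt => /orP[/eqP -> //|]; exact: nb.
have [iBt nIBt] := hB t (ltnSn t).
have [a [Ia nBt_a]] : exists a, I a /\ ~ B t a.
  by apply: contrapT => na; apply: nIBt => a ?; apply: contrapT => ?; apply: na; exists a.
have [[c hc]|nc] := pselect (exists c, forall i, (i < t)%N -> ~ B i (a + c * b)).
  have [_ ID IM] := I_ideal; exists (a + c * b); first by apply: ID => //; apply: IM.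
  move=> i; rewrite ltnS leq_eqVlt => /orP[/eqP -> |]; last exact: hc.
  move=> h; apply: nBt_a; rewrite -(addrK (c * b) a); apply: idealB => //.
  by case: iBt => _ _; apply.
exfalso; apply: A_res.
(* [g i] is the only residue class of [c] for which [a + c * b] can lie in [B i]: two such classes
   would put a unit multiple of [b] in [B i]. So there would be only finitely many residue
   classes. *)
pose g i := [set z | exists2 c, B i (a + c * b) & m (z - c)].
apply: (@sub_finite_set _ _ (g @` `I_t)); last exact/finite_image/finite_II.
have [im _ _] := local_maximal; have [_ mD mM] := im.
move=> _ [c _ <-]; have [i [it Bi]] : exists i, (i < t)%N /\ B i (a + c * b).
  apply: contrapT => ni; apply: nc; exists c => i it Bi; apply: ni; by exists i.
exists i => //; apply/seteqP; split=> z /=; last by exists c.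
move=> [c' Bi' mzc']; have [iBi _] := hB i (ltnW it).
have -> : z - c = (z - c') - (c - c') by ring.
apply: idealB => //; apply: contrapT => /local_unit[r rc]; apply: (nb i it).
have -> : b = r * ((a + c * b) - (a + c' * b)).
  by rewrite -[LHS]mul1r -rc; ring.
by have [_ _ BM] := iBi; apply: BM; exact: idealB.
Qed.

(** The generators are eliminated one by one. As [I] lies in [m], modulo [N] and the remaining
    generators [b] is congruent to [r * b] with [r] in [m], and [1 - r] is a unit. *)
Lemma nakayama (s : seq A) N M : ideal N -> ideal M -> [set` s] `<=` M ->
  M `<=` msum N (ideal_gen [set` s]) -> M `<=` msum N (ideal_mul I M) -> M `<=` N.
Proof.
move=> iN iM + + MN; elim: s => [|b s IHs] sM Ms.
  move=> a /Ms[c Nc /ideal_gen_nil/eqP]; rewrite subr_eq0 => /eqP -> //.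
have iG := ideal_genP [set` s].
have iN1 : ideal (msum N (ideal_gen [set` s])).
  by apply/submodT/submod_msum; apply/submodT.
have [N10 N1D N1M] := iN1.
have G0 : ideal_gen [set` s] 0 by case: iG.
have N0 : N 0 by case: iN.
have MA : M `<=` adjoin (msum N (ideal_gen [set` s])) b.
  apply: subset_trans Ms _; apply: (@msum_sub _ setT).
  - by apply/submodT/adjoinP.
  - exact: subset_trans (msum_subl G0) (@sub_adjoin _ _ b).
  - apply: ideal_gen_sub => [|z /=]; first exact: adjoinP.
    rewrite inE => /orP[/eqP ->|zs]; first exact: mem_adjoin.
    by apply/sub_adjoin/msum_subr => //; exact: mem_ideal_gen.
apply: IHs => [z zs|]; first by apply: sM; rewrite /= inE zs orbT.
apply: (subset_trans MA); apply: adjoin_sub => //.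
have [im _ _] := local_maximal; have [m0 mD mM] := im.
have IMb : ideal_mul I M `<=`
    [set v | exists2 r, m r & msum N (ideal_gen [set` s]) (v - r * b)].
  apply: ideal_gen_sub => [|_ [a /Im ma [v /MA[r vr] <-]]].
    split; first by exists 0; rewrite // mul0r subr0.
      move=> u v [r mr ur] [r' mr' vr']; exists (r + r'); first exact: mD.
      by rewrite mulrDl opprD addrACA; apply: N1D.
    move=> c v [r mr vr]; exists (c * r); first exact: mM.
    by rewrite -mulrA -mulrBr; apply: N1M.
  exists (a * r); first by rewrite mulrC; exact: mM.
  by rewrite -mulrA -mulrBr; apply: N1M.
have Mb : M b by apply: sM; rewrite /= mem_head.
have [c Nc /IMb[r mr cr]] := MN b Mb.
have [|u ur] := @local_unit (1 - r).
  move=> m1r; have [_ mT _] := local_maximal; apply: mT; apply: ideal_eqT => //.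
  by rewrite -(subrK r 1); apply: mD.
have -> : b = u * (c + (b - c - r * b)).
  by rewrite -[LHS]mul1r -ur; ring.
by apply/N1M/N1D => //; apply: msum_subl.
Qed.

(* Families [Q] as below encode homogeneous ideals of the Rees algebra. *)
Definition graded_ideal Q : Prop :=
  [/\ (forall n, ideal (Q n)), (forall n, Q n `<=` E n)
    & (forall n a b, I a -> Q n b -> Q n.+1 (a * b))].

(* [z], in degree [p], lies outside of the saturation of [Q]. *)
Definition nsat Q p z : Prop :=
  forall n, ~ (forall w, E n w -> Q (n + p)%N (z * w)).

(** Multiplication by [y] is onto in the cyclic module of [z] modulo [Q], from degree [n] to [n.+1]
    counted from the generator [z], itself of degree [p]. *)
Definition surj_at Q y p z n : Prop :=
  forall w, E n.+1 w -> exists2 u, E n u & Q (n + p).+1 (z * w - y * z * u).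

(** An eventual bound on the Hilbert function of the quotient by [Q], used as induction measure. *)
Definition room Q n0 r : Prop :=
  forall n, (n0 <= n)%N -> len_le setT (E n) (Q n) r.

(** The degree [n] part of [Q] enlarged by [z]; because of the truncated subtraction it has this
    meaning only for [p <= n]. *)
Definition gadjoin Q p z n : set A :=
  [set v | exists2 u, E (n - p) u & Q n (v - z * u)].

Lemma ideal_exp_mull n a b : I a -> E n b -> E n.+1 (a * b).
Proof. by move=> Ia Eb; apply: mem_ideal_gen; exists a => //; exists b. Qed.

Lemma ideal_expS_sub n (J : set A) : ideal J ->
  (forall a b, I a -> E n b -> J (a * b)) -> E n.+1 `<=` J.
Proof. by move=> iJ h; apply: ideal_gen_sub => // _ [a Ia [b Eb <-]]; exact: h. Qed.

Lemma surj_at_le Q y p z n n' : graded_ideal Q ->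
  (n <= n')%N -> surj_at Q y p z n -> surj_at Q y p z n'.
Proof.
move=> [iQ QE QM] /subnKC <- h; elim: (n' - n)%N => [|k IHk]; first by rewrite addn0.
rewrite addnS; move: (n + k)%N IHk => {h k n'}n h.
have [Q0 QD QR] := iQ (n.+1 + p).+1; have [E0 ED ER] := ideal_expP I n.+1.
apply: ideal_expS_sub => [|a b Ia /h[u Eu Qu]].
  split; first by exists 0 => //; rewrite !mulr0 subr0.
    move=> w w' [u Eu Qu] [u' Eu' Qu']; exists (u + u'); first exact: ED.
    by rewrite !mulrDr opprD addrACA; apply: QD.
  move=> r w [u Eu Qu]; exists (r * u); first exact: ER.
  have -> : z * (r * w) - y * z * (r * u) = r * (z * w - y * z * u) by ring.
  exact: QR.
exists (a * u); first exact: ideal_exp_mull.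
have -> : z * (a * b) - y * z * (a * u) = a * (z * b - y * z * u) by ring.
exact: QM.
Qed.

Lemma sat_le Q p z n n' : graded_ideal Q -> (n <= n')%N ->
  (forall w, E n w -> Q (n + p)%N (z * w)) -> forall w, E n' w -> Q (n' + p)%N (z * w).
Proof.
move=> [iQ QE QM] /subnKC <- h; elim: (n' - n)%N => [|k IHk]; first by rewrite addn0.
rewrite addnS; move: (n + k)%N IHk => {h k n'}n h.
have [Q0 QD QR] := iQ (n.+1 + p)%N.
apply: ideal_expS_sub => [|a b Ia /h Qb]; last by rewrite mulrCA; exact: QM.
split; first by rewrite mulr0.
  by move=> u v; rewrite mulrDr; exact: QD.
by move=> r u; rewrite mulrCA; exact: QR.
Qed.

Lemma gadjoin_ideal Q p z n : graded_ideal Q -> ideal (gadjoin Q p z n).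
Proof.
move=> [iQ _ _]; have [Q0 QD QR] := iQ n; have [E0 ED ER] := ideal_expP I (n - p).
split; first by exists 0 => //; rewrite mulr0 subr0.
  move=> v v' [u Eu Qu] [u' Eu' Qu']; exists (u + u'); first exact: ED.
  by rewrite mulrDr opprD addrACA; apply: QD.
move=> r v [u Eu Qu]; exists (r * u); first exact: ER.
by rewrite mulrCA -mulrBr; apply: QR.
Qed.

Lemma sub_gadjoin Q p z n : Q n `<=` gadjoin Q p z n.
Proof.
by move=> v Qv; exists 0; [case: (ideal_expP I (n - p))|rewrite mulr0 subr0].
Qed.

Lemma gadjoin_sub Q p z n : graded_ideal Q -> E p z -> (p <= n)%N ->
  gadjoin Q p z n `<=` E n.
Proof.
move=> [_ QE _] Ez pn v [u Eu /QE Ev]; rewrite -(subrK (z * u) v).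
have [_ ED _] := ideal_expP I n; apply: ED => //.
by rewrite -(subnKC pn); exact: ideal_expM.
Qed.

Lemma gadjoin_proper Q p z n : graded_ideal Q -> nsat Q p z -> (p <= n)%N ->
  ~ (gadjoin Q p z n `<=` Q n).
Proof.
move=> [iQ _ _] nz pn h; apply: (nz (n - p)%N) => w Ew; rewrite subnK //.
by apply: h; exists w => //; rewrite subrr; case: (iQ n).
Qed.

(* A strictly decreasing sequence [z], [y1 z], [y2 y1 z], ... of principal
   graded ideals modulo [Q] has length at most [r]. *)
Lemma graded_generator Q n0 r p z : graded_ideal Q -> room Q n0 r ->
  E p z -> nsat Q p z ->
  exists p z, [/\ E p z, nsat Q p z & forall y, I y ->
    ~ nsat Q p.+1 (y * z) \/ exists n, surj_at Q y p z n].
Proof.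
move=> gQ Qr Ez nz; apply: contrapT => H.
have {}H p' z' : E p' z' -> nsat Q p' z' ->
    exists y, [/\ I y, nsat Q p'.+1 (y * z') & forall n, ~ surj_at Q y p' z' n].
  move=> Ez' nz'; apply: contrapT => ny; apply: H; exists p', z'; split=> // y Iy.
  apply: contrapT => /not_orP[/contrapT nyz ns]; apply: ny; exists y; split=> // n sn.
  by apply: ns; exists n.
(* The principal ideals are compared in a single degree [n], and the chain is built upwards from the
   smallest of them. *)
have chain k p' z' n : E p' z' -> nsat Q p' z' -> (p' + k <= n)%N ->
    exists2 c, strict_chain (mitv setT (E n) (Q n)) k c & c k = gadjoin Q p' z' n.
  have itv q y : E q y -> (q <= n)%N -> mitv setT (E n) (Q n) (gadjoin Q q y n).
    move=> Ey qn; split; [exact/submodT/gadjoin_ideal|exact: sub_gadjoin|].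
    exact: gadjoin_sub.
  elim: k p' z' => [|k IHk] p' z' Ez' nz' pn.
    exists (fun=> gadjoin Q p' z' n) => //; split=> // i _; apply: itv => //.
    by rewrite -(addn0 p').
  have [y [Iy nyz ns]] := H p' z' Ez' nz'.
  have Eyz := ideal_exp_mull Iy Ez'.
  have [|c Fc ec] := IHk p'.+1 (y * z') Eyz nyz; first by rewrite addSnnS.
  have pn' : (p' < n)%N by lia.
  eexists; first apply: (strict_chain_rcons Fc (itv _ _ Ez' (ltnW pn'))).
    rewrite ec; split.
      move=> v [u Eu Qu]; exists (y * u); last by rewrite mulrA [z' * y]mulrC.
      by rewrite -(subnSK pn'); exact: ideal_exp_mull.
    move=> h; apply: (ns (n - p'.+1)%N) => w; rewrite subnSK // => Ew.
    have [|u Eu Qu] := h (z' * w).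
      by exists w => //; rewrite subrr; case: gQ => /(_ n)[].
    by exists u => //; rewrite -addnS subnK.
  by rewrite /= ltnn.
pose n := maxn n0 (p + r.+1).
have [c Fc _] := chain r.+1 p z n Ez nz (leq_maxr _ _).
by have := Qr n (leq_maxl _ _) _ _ Fc; rewrite ltnn.
Qed.

Lemma len_le_proper (J K L : set A) r : ideal K -> K `<=` J -> K `<` L ->
  len_le setT J K r.+1 -> len_le setT J L r.
Proof.
move=> iK KJ [KL nLK] b k c [Fc Sc].
suff /b : strict_chain (mitv setT J K) k.+1 (fun i => if i is j.+1 then c j else K) by [].
split=> [[|i]|[|i]] //.
- by move=> _; split=> //; exact/submodT.
- by rewrite ltnS => /Fc[sc Lc cJ]; split=> //; apply: subset_trans Lc.
- move=> _; have [_ Lc _] := Fc 0%N (leq0n k); split; first exact: subset_trans Lc.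
  by move=> h; apply/nLK/(subset_trans Lc).
- by rewrite ltnS => /Sc.
Qed.

(** The [y] sending [z] into the saturation of [Q]. A [y] in [I] outside of this ideal is surjective
    on the cyclic module of the [z] given by [graded_generator]. *)
Definition sat_ideal Q p z : set A :=
  [set y | exists n, forall w, E n w -> Q (n + p.+1)%N (y * z * w)].

Lemma sat_idealP Q p z : graded_ideal Q -> ideal (sat_ideal Q p z).
Proof.
move=> gQ; have [iQ _ _] := gQ; split.
- by exists 0%N => w _; rewrite !mul0r; case: (iQ (0 + p.+1)%N).
- move=> y y' [n hn] [n' hn']; exists (maxn n n') => w Ew; rewrite !mulrDl.
  have [_ QD _] := iQ (maxn n n' + p.+1)%N; apply: QD.
    exact: sat_le gQ (leq_maxl _ _) hn _ Ew.
  exact: sat_le gQ (leq_maxr _ _) hn' _ Ew.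
- move=> r y [n hn]; exists n => w Ew; rewrite -!mulrA.
  by have [_ _] := iQ (n + p.+1)%N; apply; rewrite mulrA; exact: hn.
Qed.

(** [I] is finitely generated, so one degree [N] would serve for all its generators, and [z] times
    [E N.+1] would lie in [Q]. *)
Lemma sat_ideal_proper Q p z : graded_ideal Q -> nsat Q p z ->
  ~ (I `<=` sat_ideal Q p z).
Proof.
move=> gQ nz sI; have [iQ _ _] := gQ; have [s es] := A_noeth I_ideal.
have [N hN] : exists N : nat, forall y, y \in s -> forall w, E N w -> Q (N + p.+1)%N (y * z * w).
  have : [set` s] `<=` sat_ideal Q p z.
    by move=> y ys; apply: sI; rewrite es; exact: mem_ideal_gen.
  elim: s {es} => [|y s IHs] ss; first by exists 0%N.
  have [|N hN] := IHs; first by move=> v vs; apply: ss; rewrite /= inE vs orbT.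
  have [n hn] : sat_ideal Q p z y by apply: ss; rewrite /= mem_head.
  exists (maxn n N) => v; rewrite inE => /orP[/eqP ->|/hN{}hN].
    exact: sat_le gQ (leq_maxl _ _) hn.
  exact: sat_le gQ (leq_maxr _ _) hN.
apply: (nz N.+1); have [Q0 QD QR] := iQ (N.+1 + p)%N.
have iX (u : A) : ideal [set y | Q (N.+1 + p)%N (y * u)].
  split=> [|a b|r a] /=; rewrite ?mul0r ?mulrDl -?mulrA //; [exact: QD|exact: QR].
move=> w Ew; rewrite mulrC; apply: (ideal_expS_sub (iX z) _ Ew) => a b Ia Eb /=.
have -> : a * b * z = a * (z * b) by ring.
have : ideal_gen [set` s] a by rewrite -es.
apply: (ideal_gen_sub (iX (z * b))) => y ys /=.
by rewrite mulrA addSnnS; exact: hN.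
Qed.

(** Induction on [r]: adjoining the [z] of [graded_generator] to [Q] lowers the bound by one. The
    [y] found there is also required to avoid [sat_ideal Q p z], hence is surjective on the cyclic
    module of [z], and the two surjectivities combine. The family [B] carries these conditions. *)
Lemma surj_mod_exists r Q n0 t (B : nat -> set A) : graded_ideal Q -> room Q n0 r ->
  (forall i, (i < t)%N -> ideal (B i) /\ ~ (I `<=` B i)) ->
  exists y, [/\ I y, (forall i, (i < t)%N -> ~ B i y)
    & exists N : nat, forall n w, (N <= n)%N -> E n.+1 w ->
        exists2 u, E n u & Q n.+1 (w - y * u)].
Proof.
elim: r Q n0 t B => [|r IHr] Q n0 t B gQ Qr hB; have [iQ QE QM] := gQ;
  (* If [1] lies in the saturation, then [Q n] is all of [E n] for large [n], and [u = 0] works for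
     any [y]. *)
  (have [n1|/existsNP[n /contrapT hn]] := pselect (nsat Q 0 1); last first;
    [have [y Iy yB] := ideal_avoidance hB; exists y; split=> //; exists n => p w np Ew;
     exists 0; [by case: (ideal_expP I p)|];
     rewrite mulr0 subr0 -(addn0 p.+1) -[w]mul1r;
     exact: sat_le gQ (leqW np) hn _ Ew|]).
- exfalso; apply: (n1 n0) => w Ew; rewrite mul1r addn0.
  apply: (len_le0 _ _ (QE n0) (Qr n0 (leqnn _))) Ew; apply/submodT => //.
  exact: ideal_expP.
- have [p [z [Ez nz hz]]] := graded_generator gQ Qr (Logic.I : E 0%N 1) n1.
  pose Q' n := if (p <= n)%N then gadjoin Q p z n else Q n.
  have gQ' : graded_ideal Q'.
    split=> n; rewrite /Q'; case: (leqP p n) => pn //.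
    + exact: gadjoin_ideal.
    + exact: gadjoin_sub.
    + move=> a b Ia [u Eu Qu]; rewrite (leqW pn); exists (a * u).
        by rewrite subSn //; exact: ideal_exp_mull.
      by rewrite mulrCA -mulrBr; exact: QM.
    + move=> a b Ia Qb; case: ifP => _; last exact: QM.
      by apply: sub_gadjoin; exact: QM.
  have Qr' : room Q' (maxn n0 p) r.
    move=> n; rewrite geq_max /Q' => /andP[n0n pn]; rewrite pn.
    apply: len_le_proper (iQ n) (QE n) _ (Qr n n0n); split; first exact: sub_gadjoin.
    exact: gadjoin_proper.
  pose B' i := if (i < t)%N then B i else sat_ideal Q p z.
  have [i|y [Iy yB' [N hN]]] := IHr Q' (maxn n0 p) t.+1 B' gQ' Qr'.
    rewrite /B'; case: (ltnP i t) => [it _|_ _]; first exact: hB.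
    by split; [exact: sat_idealP|exact: sat_ideal_proper].
  exists y; split=> // [i it|].
    by have := yB' i (leqW it); rewrite /B' it.
  have [nyz|[n1' hn1]] := hz y Iy.
    exfalso; have := yB' t (ltnSn t); rewrite /B' ltnn; apply.
    by move: nyz => /existsNP[n /contrapT hn]; exists n.
  exists (maxn N (n1' + p)) => n w; rewrite geq_max => /andP[Nn npn] Ew.
  have [u Eu] := hN n w Nn Ew; rewrite /Q' (_ : (p <= n.+1)%N); last by lia.
  have pn : (p <= n)%N by lia.
  move=> [u']; rewrite subSn // => Eu' Qu'.
  have [|u2 Eu2] := surj_at_le gQ (_ : (n1' <= n - p)%N) hn1 Eu'; first by lia.
  rewrite subnK // => Qu2; exists (u + z * u2).
    have [_ ED _] := ideal_expP I n; apply: ED => //.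
    by rewrite -(subnKC pn); exact: ideal_expM.
  have -> : w - y * (u + z * u2) = (w - y * u - z * u') + (z * u' - y * z * u2) by ring.
  by have [_ QD _] := iQ n.+1; exact: QD.
Qed.

(** For [Q n = E n.+1] the quotient is the associated graded ring. Nakayama then lifts the
    surjectivity of [y] from there to the powers of [I]. *)
Lemma reduction_exists n0 C :
  (forall n, (n0 <= n)%N -> len_le setT (E n) (E n.+1) C) ->
  exists2 y, I y & exists N : nat, forall n w, (N <= n)%N -> E n.+1 w ->
    exists2 u, E n u & w = y * u.
Proof.
move=> hC.
have gQ : graded_ideal (fun n => E n.+1).
  split=> n; [exact: ideal_expP|exact: ideal_expS|exact: ideal_exp_mull].
have [//|y [Iy _ [N hN]]] := @surj_mod_exists C _ n0 0 (fun=> setT) gQ hC.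
exists y => //; exists N => n w Nn; have [s es] := A_noeth (ideal_expP I n.+1).
have [E0 ED EM] := ideal_expP I n.
have iN : ideal [set v | exists2 u, E n u & v = y * u].
  split; first by exists 0; rewrite ?mulr0.
    move=> _ _ [u Eu ->] [v Ev ->]; exists (u + v); [exact: ED|by rewrite mulrDr].
  by move=> r _ [u Eu ->]; exists (r * u); [exact: EM|rewrite mulrCA].
apply: (@nakayama s _ (E n.+1) iN (ideal_expP I n.+1)).
- by move=> a sa; rewrite es; exact: mem_ideal_gen.
- by rewrite -es; apply: msum_subr; case: iN.
- move=> a Ea; have [u Eu Eau] := hN n a Nn Ea; exists (y * u) => //.
  by exists u.
Qed.

End Reduction.

(** * The degree filtration of the associated graded ring *)

Section GradedFiltration.
Local Open Scope quotient_scope.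
Variables (A : comNzRingType) (I : set A).
Local Notation E := (ideal_exp I).
Local Notation G := (assoc_graded I).
Implicit Types (p q : rees I).

Definition to_gr p : G := \pi_G p.

Lemma reesP p n : E n (rees_poly p)`_n.
Proof. by case: p => p /= /asboolP. Qed.

Lemma to_gr_surj (g : G) : exists p, g = to_gr p.
Proof. by exists (repr g); rewrite /to_gr reprK. Qed.

Lemma to_grD p q : to_gr (p + q) = to_gr p + to_gr q.
Proof. exact: (raddfD (\pi_{ideal_quot (@rees_shift A I)}) p q). Qed.

Lemma to_grN p : to_gr (- p) = - to_gr p.
Proof. exact: (raddfN (\pi_{ideal_quot (@rees_shift A I)}) p). Qed.

Lemma to_gr0 : to_gr 0 = 0.
Proof. exact: (raddf0 (\pi_{ideal_quot (@rees_shift A I)})). Qed.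

Lemma to_grM p q : to_gr (p * q) = to_gr p * to_gr q.
Proof. by rewrite /to_gr -pi_gr_mul. Qed.

Lemma to_gr_eq p q :
  (to_gr p = to_gr q) <-> (forall n, E n.+1 ((rees_poly p)`_n - (rees_poly q)`_n)).
Proof.
have e : rees_poly (p - q) = rees_poly p - rees_poly q.
  by rewrite -[LHS]/(val (p - q)) rmorphB.
have s : (p - q \in @rees_shift A I) = (to_gr p == to_gr q) by rewrite Quotient.idealrBE.
split=> [/eqP|h]; last first.
  by apply/eqP; rewrite -s; apply/asboolP => n; rewrite e coefB.
by rewrite -s => /asboolP h n; have := h n; rewrite e coefB.
Qed.

Lemma reesD p q : rees_poly (p + q) = rees_poly p + rees_poly q.
Proof. by rewrite -[LHS]/(val (p + q)) rmorphD. Qed.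

Lemma reesN p : rees_poly (- p) = - rees_poly p.
Proof. by rewrite -[LHS]/(val (- p)) rmorphN. Qed.

Lemma reesM p q : rees_poly (p * q) = rees_poly p * rees_poly q.
Proof. by rewrite -[LHS]/(val (p * q)) rmorphM. Qed.

(** The default value [0] is taken unless [a] lies in [E n]. *)
Definition rees_mono n a : rees I := insubd (0 : rees I) (a *: 'X^n).

Lemma rees_monoE n a : E n a -> rees_poly (rees_mono n a) = a *: 'X^n.
Proof.
move=> Ea; rewrite -[LHS]/(val (rees_mono n a)) insubdK //.
apply/asboolP => i; rewrite coefZ coefXn; case: eqP => [->|_]; first by rewrite mulr1.
by rewrite mulr0; case: (ideal_expP I i).
Qed.

Definition gr_fil n : set G := [set g | exists2 p, (size (rees_poly p) <= n)%N & g = to_gr p].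

(** Coefficients in [E i.+1] vanish in the associated graded ring, so the polynomial can be
    truncated. *)
Lemma gr_fil_take n p :
  (forall i, (n <= i)%N -> E i.+1 (rees_poly p)`_i) -> gr_fil n (to_gr p).
Proof.
move=> h; have tp : take_poly n (rees_poly p) \in @rees_pred A I.
  apply/asboolP => i; rewrite coef_take_poly; case: ifP => _; first exact: reesP.
  by case: (ideal_expP I i).
exists (Rees tp); first by rewrite /= size_take_poly.
apply/to_gr_eq => i /=; rewrite coef_take_poly; case: ltnP => [_|/h]; last by rewrite subr0.
by rewrite subrr; case: (ideal_expP I i.+1).
Qed.

Lemma to_gr_mono0 n a : E n.+1 a -> to_gr (rees_mono n a) = 0.
Proof.
move=> Ea; rewrite -to_gr0; apply/to_gr_eq => i.
rewrite rees_monoE; last exact: ideal_expS.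
rewrite -[rees_poly 0]/(val (0 : rees I)) rmorph0 coef0 subr0 coefZ coefXn.
case: eqP => [->|_]; first by rewrite mulr1.
by rewrite mulr0; case: (ideal_expP I i.+1).
Qed.

Lemma rees_monoD n a b : E n a -> E n b ->
  rees_mono n (a + b) = rees_mono n a + rees_mono n b.
Proof.
move=> Ea Eb; apply: val_inj; rewrite rmorphD /=.
have [_ ED _] := ideal_expP I n.
by rewrite !rees_monoE // ?scalerDl //; exact: ED.
Qed.

Lemma rees_monoM n k a b : E n a -> E k b ->
  rees_mono (n + k) (a * b) = rees_mono n a * rees_mono k b.
Proof.
move=> Ea Eb; apply: val_inj; rewrite rmorphM /=.
rewrite !rees_monoE //; last exact: ideal_expM.
by rewrite -scalerAl -scalerAr scalerA exprD.
Qed.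

Lemma gr_fil_lead n g : gr_fil n.+1 g ->
  exists a g', [/\ E n a, gr_fil n g' & g = to_gr (rees_mono n a) + g'].
Proof.
move=> [p sp ->]; pose a := (rees_poly p)`_n; have Ea : E n a := reesP p n.
exists a, (to_gr (p - rees_mono n a)); split=> //; last first.
  by rewrite -to_grD addrC subrK.
apply: gr_fil_take => i ni; rewrite reesD reesN coefB rees_monoE // coefZ coefXn.
case: eqP => [->|/eqP ni']; first by rewrite mulr1 subrr; case: (ideal_expP I n.+1).
rewrite mulr0 subr0 nth_default; first by case: (ideal_expP I i.+1).
by apply: leq_trans sp _; rewrite ltn_neqAle eq_sym ni'.
Qed.

Lemma gr_fil_mono n a : E n a -> gr_fil n.+1 (to_gr (rees_mono n a)).
Proof.
move=> Ea; exists (rees_mono n a) => //; rewrite rees_monoE //.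
by apply: leq_trans (size_scale_leq _ _) _; rewrite size_polyXn.
Qed.

Lemma gr_filtration C : (forall n, len_le setT (E n) (E n.+1) C) -> filtration gr_fil C.
Proof.
move=> hC; have fZ n : gr_fil n 0.
  by rewrite -to_gr0; exists 0 => //; rewrite -[rees_poly 0]/(val (0 : rees I)) rmorph0 size_poly0.
have fD n a b : gr_fil n a -> gr_fil n b -> gr_fil n (a + b).
  move=> [p sp ->] [q sq ->]; rewrite -to_grD; exists (p + q) => //; rewrite reesD.
  by apply: leq_trans (size_polyD _ _) _; rewrite geq_max sp sq.
have fN n a : gr_fil n a -> gr_fil n (- a).
  by move=> [p sp ->]; rewrite -to_grN; exists (- p) => //; rewrite reesN size_polyN.
have f1 : gr_fil 1 1.
  by exists 1; rewrite // -[rees_poly 1]/(val (1 : rees I)) rmorph1 size_poly1.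
have fS n : gr_fil n `<=` gr_fil n.+1.
  by move=> _ [p sp ->]; exists p => //; exact: leqW.
split=> //.
- move=> _ [p sp ->]; rewrite -to_gr0; congr to_gr; apply: val_inj; rewrite rmorph0.
  by apply/eqP; rewrite -size_poly_leq0.
- move=> n k _ _ [p sp ->] [q sq ->]; rewrite -to_grM; exists (p * q) => //.
  rewrite reesM; apply: leq_trans (size_polyMleq _ _) _.
  by move: sp sq; lia.
- by move=> g; have [p ->] := to_gr_surj g; exists (size (rees_poly p)), p.
(* Leading coefficients turn a submodule between [gr_fil n] and [gr_fil n.+1] into an ideal between
   [E n.+1] and [E n]. *)
move=> n k c hc; pose f (L : set G) := [set a | E n a /\ L (to_gr (rees_mono n a))].
have h := @strict_chain_map _ _ _ (mitv setT (E n) (E n.+1)) f k c _ _ hc.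
have [E0 ED EM] := ideal_expP I n.
apply: (hC n); apply: h => [L [sL FL LF]|L L' [sL FL LF] [sL' FL' LF'] [LL nLL]].
  have [L0 LD LM] := sL; split; last by move=> a [].
    split.
    - by split=> //; rewrite to_gr_mono0 //; case: (ideal_expP I n.+1).
    - move=> a b [Ea La] [Eb Lb]; split; first exact: ED.
      by rewrite rees_monoD // to_grD; exact: LD.
    - move=> r a _ [Ea La]; split; first exact: EM.
      rewrite -(add0n n) rees_monoM // to_grM; apply: LM => //.
      exact: (gr_fil_mono (n := 0)).
  by move=> a Ea; split; [exact: ideal_expS|rewrite to_gr_mono0].
split; first by move=> a [Ea La]; split=> //; exact: LL.
move=> hS; apply: nLL => g Lg; have [a [g' [Ea Fg' eg]]] := gr_fil_lead (LF' _ Lg).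
have [|_ La] := hS a; last by rewrite eg; case: sL => _ LD _; apply: LD => //; exact: FL.
split=> //; have -> : to_gr (rees_mono n a) = g + - g' by rewrite eg addrK.
by case: sL' => _ LD _; apply: LD => //; apply/FL'/fN.
Qed.

Lemma gr_fil_gen x N0 : I x ->
  (forall n a, (N0 <= n)%N -> E n.+1 a -> exists2 u, E n u & E n.+2 (a - x * u)) ->
  forall n g, (N0 <= n)%N -> gr_fil n.+2 g ->
  exists b c, [/\ gr_fil n.+1 b, gr_fil n.+1 c
    & g = to_gr (rees_mono 1 x) * b + c].
Proof.
move=> Ix hx n g Nn /gr_fil_lead[a [g' [Ea Fg' ->]]].
have Ex : E 1 x by apply: mem_ideal_gen; exists x => //; exists 1; rewrite ?mulr1.
have [u Eu Eau] := hx n a Nn Ea; have Exu := ideal_expM Ex Eu.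
exists (to_gr (rees_mono n u)), g'; split=> //; first exact: gr_fil_mono.
rewrite -to_grM -rees_monoM // -[a in LHS](subrK (x * u)) rees_monoD //.
  by rewrite to_grD (to_gr_mono0 Eau) add0r.
exact: ideal_expS.
Qed.

Lemma gr_regular x : I x -> (forall n a, E n.+1 (x * a) -> E n a) ->
  forall n g, gr_fil n.+1 (to_gr (rees_mono 1 x) * g) -> gr_fil n g.
Proof.
move=> Ix hx n g; have [p ->] := to_gr_surj g; rewrite -to_grM => -[q sq].
have Ex : E 1 x by apply: mem_ideal_gen; exists x => //; exists 1; rewrite ?mulr1.
move=> /to_gr_eq h; apply: gr_fil_take => i ni; apply: hx.
have := h i.+1; rewrite reesM rees_monoE // -scalerAl coefZ expr1.
by rewrite coefXM /= [X in _ - X]nth_default ?subr0 //; apply: leq_trans sq _.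
Qed.

End GradedFiltration.

(** * Hilbert coefficients and principal reductions *)

Section HilbertCoefficients.
Implicit Types (h : {poly int}).

Lemma hilbert_coefE h i K : (size h <= K)%N ->
  hilbert_coef h i = \sum_(n < K) h`_n *+ 'C(n, i).
Proof.
move=> hK; rewrite /hilbert_coef -{1}[h]coefK poly_def.
have -> : \sum_(n < size h) h`_n *: 'X^n = \sum_(n < K) h`_n *: 'X^n.
  rewrite (big_ord_widen K (fun n => h`_n *: 'X^n) hK).
  rewrite [RHS](bigID (fun n : 'I_K => (n < size h)%N)) /=.
  rewrite [X in _ = _ + X]big1 ?addr0 // => n; rewrite -leqNgt => hn.
  by rewrite nth_default // scale0r.
rewrite raddf_sum /= horner_sum; apply: eq_bigr => n _.
by rewrite nderivnZ nderivnXn hornerZ hornerMn hornerXn expr1n mulrnAr mulr1.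
Qed.

(** The coefficient of index [n.+1] enters with weight ['C(n.+1, 2) - 'C(n.+1, 1) + 1], which is
    ['C(n, 2)], and the constant one cancels against [l]. *)
Lemma hilbert_coef_relation h l K : (size h <= K.+1)%N -> h`_0 = l%:Z ->
  hilbert_coef h 2 = hilbert_coef h 1 - hilbert_coef h 0 + l%:Z ->
  \sum_(n < K) h`_n.+1 *+ 'C(n, 2) = 0.
Proof.
move=> hK h0; rewrite !(hilbert_coefE _ hK) !big_ord_recl /= h0.
rewrite /bump /= !mulr0n !add0r mulr1n => e.
have {e} : \sum_(i < K) h`_(1 + i) *+ 'C(1 + i, 2) - \sum_(i < K) h`_(1 + i) *+ 'C(1 + i, 1)
   + \sum_(i < K) h`_(1 + i) *+ 'C(1 + i, 0) = 0 by rewrite e; ring.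
move=> e; rewrite -[RHS]e -sumrB -big_split /=; apply: eq_bigr => i _.
rewrite add1n bin0 binS bin1 bin1 mulrnDr mulrS mulr1n; ring.
Qed.

(** Summation by parts, with ['C(n.+1, 2) - 'C(n, 2) = n]. *)
Lemma abel_sum_binomial (v : nat -> int) K :
  \sum_(n < K) (v n - v n.+1) *+ 'C(n, 2) + v K *+ 'C(K, 2) =
  \sum_(n < K) v n.+1 *+ n.
Proof.
elim: K => [|K IHK]; first by rewrite !big_ord0 add0r mulr0n.
rewrite !big_ord_recr /= -IHK binS bin1 mulrnDr mulrnBl; ring.
Qed.

End HilbertCoefficients.

Lemma has_lengthE (A : comPzRingType) (J K : set A) n : has_length J K n = len setT J K n.
Proof.
rewrite /has_length /len; congr (chain_height _ n); apply/funext => L.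
apply/propext; split=> -[iL KL LJ]; split=> //; exact/submodT.
Qed.

(** * Lengths and colons along a principal reduction *)

Section PrincipalReduction.
Variables (A : comNzRingType) (I : set A).
Implicit Types (J K : set A) (x : A).
Local Notation E := (ideal_exp I).

Definition scale x J : set A := [set x * a | a in J].

Lemma scale_ideal x J : ideal J -> ideal (scale x J).
Proof.
move=> [J0 JD JM]; split; first by exists 0; rewrite ?mulr0.
  by move=> _ _ [a Ja <-] [b Jb <-]; exists (a + b); [exact: JD|exact: mulrDr].
by move=> r _ [a Ja <-]; exists (r * a); [exact: JM|exact: mulrCA].
Qed.

Lemma scaleS x J K : J `<=` K -> scale x J `<=` scale x K.
Proof. by move=> JK _ [a /JK Ka <-]; exists a. Qed.

Lemma scale_sub x J : ideal J -> scale x J `<=` J.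
Proof. by move=> [_ _ JM] _ [a Ja <-]; exact: JM. Qed.

Lemma scaleI x J a : regular x -> scale x J (x * a) -> J a.
Proof.
move=> rx [b Jb /eqP]; rewrite -subr_eq0 -mulrBr => /eqP/rx/eqP.
by rewrite subr_eq0 => /eqP <-.
Qed.

(** Multiplication by [x] carries chains forward, and the colon by [x] carries them back. *)
Lemma len_scale x J K n : regular x ->
  len setT J K n -> len setT (scale x J) (scale x K) n.
Proof.
move=> rx [[c hc] bn]; split.
  exists (scale x \o c); apply: strict_chain_map hc => [L [/submodT iL KL LJ]|L L' _ _ [LL nLL]].
    by split; [exact/submodT/scale_ideal|exact: scaleS|exact: scaleS].
  split; first exact: scaleS.
  move=> h; apply: nLL => a La; apply: (scaleI rx); apply: h; by exists a.
move=> k e he; apply: (bn k ((fun L => [set a | L (x * a)]) \o e)).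
apply: strict_chain_map he => [L [[L0 LD LM] KL LJ]|L L' [_ _ LJ] [_ _ LJ'] [LL nLL]].
  split.
  - split=> [|a b La Lb|r a rT La] /=; first by rewrite mulr0.
      by rewrite mulrDr; exact: LD.
    by rewrite mulrCA; exact: LM.
  - by move=> a Ka; apply: KL; exists a.
  - by move=> a La; apply: (scaleI rx); exact: LJ.
split; first by move=> a; exact: LL.
by move=> h; apply: nLL => z Lz; have [a _ ea] := LJ' _ Lz; rewrite -ea; apply: h; rewrite /= ea.
Qed.

Variables (H : nat -> nat) (x : A) (N : nat).
Hypothesis len_H : forall n, len setT (E n) (E n.+1) (H n).
Hypotheses (Ix : I x) (x_regular : regular x).
Hypothesis red : forall n w, (N <= n)%N -> E n.+1 w -> exists2 u, E n u & w = x * u.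

Let TN : [set: A] (-1). Proof. by []. Qed.

Let sE n : submod setT (E n). Proof. exact/submodT/ideal_expP. Qed.
Let sxE n : submod setT (scale x (E n)). Proof. exact/submodT/scale_ideal/ideal_expP. Qed.
Let sT : submod setT [set: A]. Proof. exact/submodT. Qed.

Lemma scale_exp_sub n : scale x (E n) `<=` E n.+1.
Proof. by move=> _ [a Ea <-]; exact: ideal_exp_mull. Qed.

Lemma exp_sub_scale n : (N <= n)%N -> E n.+1 `<=` scale x (E n).
Proof. by move=> Nn w /(red Nn)[u Eu ->]; exists u. Qed.

Lemma ideal_exp_le n k : (n <= k)%N -> E k `<=` E n.
Proof.
move=> /subnKC <-; elim: (k - n)%N => [|j IHj]; first by rewrite addn0.
by rewrite addnS; apply: subset_trans IHj; exact: ideal_expS.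
Qed.

Lemma len_exp n : exists k, len setT setT (E n) k.
Proof.
elim: n => [|n [k lk]]; first by exists 0%N; exact: lenxx.
exists (H n + k)%N; apply: (len_add TN (sE n) sT) lk => //; exact: ideal_expS.
Qed.

(* Comparing the two filtrations [x I^n <= x A <= A] and [x I^n <= I^n <= A]. *)
Lemma len_exp_scale : exists e, forall n, len setT (E n) (scale x (E n)) e.
Proof.
have xT : submod setT (scale x setT) by exact/submodT/scale_ideal/idealT.
(* The length is finite because [scale x (E n)] contains a high power of [I]. *)
have fin n : exists k, len setT setT (scale x (E n)) k.
  have [k lk] := len_exp (maxn n N).+1.
  have [||_ [q [_ lq _]]] := len_split TN (sxE n) (sE (maxn n N).+1) sT _ _ lk => //.
    apply: subset_trans (exp_sub_scale (leq_maxr n N)) _.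
    by apply: scaleS; apply: ideal_exp_le; exact: leq_maxl.
  by exists q.
have [e le] := fin 0%N; exists e => n.
have [s ls] := fin n; have [k lk] := len_exp n.
have [||p [q [lp lq es]]] := len_split TN xT (sxE n) sT _ _ ls => //; first exact: scaleS.
have [||p' [q' [lp' lq' es']]] := len_split TN (sE n) (sxE n) sT _ _ ls => //.
  by apply: scale_sub; exact: ideal_expP.
have ep := len_uniq lp (len_scale x_regular lk).
have eq := len_uniq lq le; have eq' := len_uniq lq' lk.
by have -> : e = p' by lia.
Qed.

Lemma len_exp_reduction : exists e, exists v : nat -> nat,
  forall n, len setT (E n.+1) (scale x (E n)) (v n) /\ (v n + H n = e)%N.
Proof.
(* The subtraction is not truncated: [e] splits below as a length plus [H n]. *)
have [e he] := len_exp_scale; exists e, (fun n => (e - H n)%N) => n.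
have [p [q [lp lq eE]]] := len_split TN (sE n.+1) (sxE n) (sE n)
  (scale_exp_sub (n := n)) (@ideal_expS _ I n) (he n).
have -> : H n = q by apply: len_uniq (len_H n) lq.
by rewrite eE addnK.
Qed.

Lemma exp_addn_reduction n j w : (N <= n)%N -> E (n + j) w ->
  exists2 u, E n u & w = x ^+ j * u.
Proof.
move=> Nn; elim: j w => [|j IHj] w.
  by rewrite addn0 => Ew; exists w => //; rewrite expr0 mul1r.
rewrite addnS => /(red (leq_trans Nn (leq_addr j n)))[w' /IHj[u Eu ->] ->].
by exists u => //; rewrite exprS mulrA.
Qed.

Lemma ideal_expX n k a : E n a -> E (k * n) (a ^+ k).
Proof.
move=> Ea; elim: k => [//|k IHk]; rewrite mulSn exprS; exact: ideal_expM.
Qed.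

(* If [x a] lies in [I^2] then [x^j a^j] lies in [I^(2j) = x^j I^j] for large
   [j], so that [a^j] lies in [I^j]. *)
Lemma integral_colon a : E 2%N (x * a) -> integral_closure I a.
Proof.
move=> Exa; pose j := N.+1.
have [|u Eu eu] := @exp_addn_reduction j j (x ^+ j * a ^+ j) (leqnSn N).
  by rewrite -exprMn addnn -muln2; exact: ideal_expX.
have au : a ^+ j = u.
  apply/eqP; rewrite -subr_eq0; apply/eqP/(regularX (k := j) x_regular).
  by rewrite mulrBr eu subrr.
(* The integral equation is [a ^+ j - u = 0], with zero intermediate coefficients. *)
exists j, (fun i => if i == j then - u else 0); rewrite au; split=> // [i _|].
  case: eqP => [->|_]; first exact: (idealN (ideal_expP I j) Eu).
  by case: (ideal_expP I i).
rewrite big_nat_recr //= eqxx subnn expr0 mulr1 big_nat big1 ?add0r ?subrr // => i.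
by move=> /andP[_ ij]; rewrite (ltn_eqF ij) mul0r.
Qed.

(** Integral closedness enters for [n = 1], through [integral_colon]; from [2] on, the regular [x]
    is cancelled. *)
Lemma exp_colon a n : integrally_closed I ->
  (forall n, (2 <= n)%N -> E n.+1 `<=` scale x (E n)) -> E n.+1 (x * a) -> E n a.
Proof.
move=> I_ic h; case: n => [//|[|n]]; last by move=> /h - /(_ isT); exact: scaleI.
move=> /integral_colon; rewrite I_ic => Ia.
by apply: mem_ideal_gen; exists a => //; exists 1; rewrite ?mulr1.
Qed.

End PrincipalReduction.

(** A high power of [a] is a multiple of [x], so it kills whatever [x] kills. *)
Lemma reduction_regular (A : comNzRingType) (I : set A) x N a k :
  (forall n w, (N <= n)%N -> ideal_exp I n.+1 w -> exists2 u, ideal_exp I n u & w = x * u) ->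
  regular a -> I (a ^+ k) -> regular x.
Proof.
move=> red ra Iak z xz.
have E1 : ideal_exp I 1 (a ^+ k).
  by apply: mem_ideal_gen; exists (a ^+ k) => //; exists 1; rewrite ?mulr1.
have := ideal_expX N.+1 E1; rewrite muln1 -exprM => /(red _ _ (leqnn N))[u _ eu].
by apply: (regularX (k := (k * N.+1)%N) ra); rewrite eu mulrAC xz mul0r.
Qed.

Theorem proposition3p1 (A : comNzRingType) (m : set A) (d : nat)
    (A_cm : cm_local m) (A_dim : krull_dim A d) (d_le1 : (d <= 1)%N)
    (A_res : infinite_residue_field m)
    (I : set A) (I_prim : is_primary_to m I) (I_ic : integrally_closed I)
    (h : {poly int}) (hI : is_h_polynomial I d h)
    (l : nat) (lI : has_length setT I l)
    (e2E : hilbert_coef h 2 = hilbert_coef h 1 - hilbert_coef h 0 + l%:Z) :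
  ((size h).-1 <= 2)%N /\ cohen_macaulay (assoc_graded I).
Proof.
have [A_noeth A_loc [d' [A_dim' [[s [rs sm sd']] _]]]] := A_cm.
have {A_dim' sd'} sd : size s = d by rewrite sd'; exact: chain_height_uniq A_dim' A_dim.
have [[iI _ _] radI] := I_prim.
have Im : I `<=` m by rewrite -radI => a Ia; exists 1%N; rewrite expr1.
have E1 : ideal_exp I 1 = I.
  apply/seteqP; split=> [|a Ia].
    apply: ideal_gen_sub => // _ [a Ia [b _ <-]]; case: iI => _ _ IM; rewrite mulrC; exact: IM.
  by apply: mem_ideal_gen; exists a => //; exists 1; rewrite ?mulr1.
have [_ [H lenH hH]] := hI.
have len_H n : len setT (ideal_exp I n) (ideal_exp I n.+1) (H n).
  by rewrite -has_lengthE.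
have sE n : submod setT (ideal_exp I n) by exact/submodT/ideal_expP.
have H0 : H 0%N = l by move: (len_H 0%N); rewrite E1 -has_lengthE => /chain_height_uniq; apply.
have h0 : h`_0 = l%:Z.
  rewrite hH big_ord_recl big_ord0 addr0 subn0 H0 /= -horner_coef0 horner_exp !hornerE.
  by rewrite ?oppr0 ?addr0 expr1n mul1r.
have rel K : (size h <= K.+1)%N -> \sum_(n < K) h`_n.+1 *+ 'C(n, 2) = 0.
  by move=> hK; exact: hilbert_coef_relation hK h0 e2E.
have szh : (forall j, (3 <= j)%N -> h`_j = 0) -> ((size h).-1 <= 2)%N.
  by move=> /leq_sizeP; lia.
case: d d_le1 {A_dim hI} sd hH => [_ _|[_|//] sd] hH.
  have hHn n : h`_n = (H n)%:Z.
    rewrite hH big_ord_recl expr0 coef1 mul1r subn0 big1 ?addr0 // => i _.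
    by rewrite coef1 mul0r.
  (* The coefficients of [h] are lengths here, so every term of the vanishing sum is zero, and the
     weight ['C(j, 2)] is positive for [2 <= j]. *)
  have hz j : (3 <= j)%N -> h`_j = 0.
    case: j => [//|j] j2; have [hK|hK] := leqP (size h) j.+1; first by rewrite nth_default.
    have := rel (maxn (size h) j.+1) (leqW (leq_maxl _ _)).
    move=> /eqP; rewrite psumr_eq0 => [/allP/(_ (Ordinal (leq_maxr (size h) j.+1)))|n _].
      rewrite mem_index_enum => /(_ isT) /=; rewrite mulrn_eq0 => /orP[|/eqP//].
      by rewrite eqn0Ngt bin_gt0 -ltnS j2.
    by rewrite hHn mulrn_wge0.
  split; first exact: szh.
  have E_stab n : (3 <= n)%N -> ideal_exp I n `<=` ideal_exp I n.+1.
    move=> n3; apply: (len_le0 (sE n) (sE n.+1) (@ideal_expS _ I n)).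
    have := hz n n3; rewrite hHn => -[e]; move: (len_H n); rewrite e; exact: len_len_le.
  have len_b n : len_le setT (ideal_exp I n) (ideal_exp I n.+1) (\sum_(i < 3) H i).
    have [n3|n3] := ltnP n 3.
      by apply: (len_leW _ (len_len_le (len_H n))); rewrite (bigD1 (Ordinal n3)) //= leq_addr.
    have := hz n n3; rewrite hHn => -[e]; move: (len_H n); rewrite e.
    by move=> /len_len_le; exact: len_leW.
  have I0 : I 0 by case: iI.
  have gF := gr_filtration len_b.
  (* The graded ring vanishes from degree [3] on, so the zero element can serve as generator. *)
  apply: (@filtered_cohen_macaulay _ _ _ gF (to_gr (rees_mono I 1 0)) 3).
  - by apply: gr_fil_mono; rewrite E1.
  - apply: gr_fil_gen => // n a n3 Ea; exists 0; first by case: (ideal_expP I n).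
    by rewrite mulr0 subr0; apply: E_stab => //; exact: leqW.
  right; exists 3%N => g; have [p ->] := to_gr_surj g; apply: gr_fil_take => i i3.
  by apply: E_stab => //; exact: reesP.
have hS n : h`_n.+1 = (H n.+1)%:Z - (H n)%:Z.
  rewrite hH 2!big_ord_recl expr1 big1 ?addr0 => [|i _].
    by rewrite !coefB !coef1 !coefX /= subr0 sub0r mul1r mulN1r subn0 subSS subn0.
  by rewrite !coefB !coef1 !coefX /= subrr mul0r.
(* The Hilbert function is constant past the degree of [h], hence bounded by the crude sum [C]. *)
have Hst n : (size h <= n)%N -> H n = H (size h).
  elim: n => [|n IHn]; first by rewrite leqn0 => /eqP ->.
  rewrite leq_eqVlt => /orP[/eqP <-//|hn]; rewrite -IHn //.
  have := hS n; rewrite nth_default; last exact: leqW.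
  by move=> /esym/eqP; rewrite subr_eq0 => /eqP[].
pose C := (\sum_(i < (size h).+1) H i)%N.
have len_b n : len_le setT (ideal_exp I n) (ideal_exp I n.+1) C.
  have b i : (i <= size h)%N -> (H i <= C)%N.
    by rewrite -ltnS => ih; rewrite /C (bigD1 (Ordinal ih)) //= leq_addr.
  apply: (len_leW _ (len_len_le (len_H n))).
  by have [/b//|/ltnW/Hst ->] := leqP n (size h); exact: b.
have [x Ix [N red]] := @reduction_exists A m I A_noeth A_loc A_res iI Im 0 C (fun n _ => len_b n).
(* Depth one gives a regular element of [m], and a power of it lies in [I]. *)
have rx : regular x.
  case: s rs sm sd => [//|a s'] /regular_seq_head ra sm _.
  have : m a by apply: sm; rewrite /= mem_head.
  by rewrite -radI => -[k Iak]; exact: reduction_regular red ra Iak.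
have [e [v hv]] := len_exp_reduction len_H Ix rx red.
have v0 n : (N <= n)%N -> v n = 0%N.
  move=> Nn; apply: len_uniq (hv n).1 _.
  rewrite (_ : ideal_exp I n.+1 = scale x (ideal_exp I n)); last first.
    by apply/seteqP; split; [exact: exp_sub_scale red _ Nn|exact: scale_exp_sub].
  exact/lenxx/submodT/scale_ideal/ideal_expP.
have hv' n : h`_n.+1 = (v n)%:Z - (v n.+1)%:Z.
  by rewrite hS; have := (hv n).2; have := (hv n.+1).2; lia.
have v2 n : (2 <= n)%N -> v n = 0%N.
  (* [K] exceeds [n], bounds the size of [h], and is at least [N], so that the boundary term [v K]
     is zero. In the remaining vanishing sum of nonnegative terms, [v n.+1] has the nonzero weight
     [n]. *)
  case: n => [//|n] n1; pose K := (maxn (size h) (maxn N n.+1)).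
  have nK : (n < K)%N by rewrite /K !leq_max leqnn !orbT.
  have NK : (N <= K)%N by rewrite /K !leq_max leqnn !orbT.
  have := abel_sum_binomial (fun n => (v n)%:Z) K; rewrite (v0 K NK) mul0rn addr0.
  under eq_bigr do rewrite -hv'.
  rewrite (rel K (leqW (leq_maxl _ _))) => /esym/eqP.
  rewrite psumr_eq0 => [/allP/(_ (Ordinal nK))|i _]; last by rewrite mulrn_wge0.
  rewrite mem_index_enum => /(_ isT) /=; rewrite mulrn_eq0 => /orP[/eqP e0|/eqP[]//].
  by move: n1; rewrite e0.
split; first by apply: szh => -[//|j] j2; rewrite hv' !v2 //; exact: leqW.
have red2 n : (2 <= n)%N -> ideal_exp I n.+1 `<=` scale x (ideal_exp I n).
  move=> n2; apply: (len_le0 (sE n.+1)); [exact/submodT/scale_ideal/ideal_expP| |].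
    exact: scale_exp_sub.
  by have [ln _] := hv n; move: ln; rewrite v2 //; exact: len_len_le.
have gF := gr_filtration len_b.
apply: (@filtered_cohen_macaulay _ _ _ gF (to_gr (rees_mono I 1 x)) 2).
- by apply: gr_fil_mono; rewrite E1.
- apply: gr_fil_gen => // n a n2 /(red2 _ n2)[u Eu <-]; exists u => //.
  by rewrite subrr; case: (ideal_expP I n.+2).
left; apply: gr_regular => // n a; exact: (exp_colon rx red I_ic red2).
Qed.
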